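(* Let $I$ be a squarefree monomial ideal of $R=K[x_1,\ldots,x_n]$. If $I$ is a Lyubeznik ideal or $I$ is an almost Lyubeznik ideal (i.e. $L(I)=\mathrm{projdim}(R/I)$), then $$ara(I)=\mathrm{projdim}(R/I)=L(I)=ps(I).$$
   Context: $K$ is a field, $G(I)$ denotes the minimal set of monomial generators of $I$, and $\mathrm{projdim}$ denotes projective dimension over $R$. The arithmetical rank $ara(I)$ is the smallest $m$ such that there exist $r_1,\ldots,r_m\in R$ with $\sqrt{I}=\sqrt{(r_1,\ldots,r_m)}$. For a total order $\prec$ on $G(I)$ write $G(I)=\{m_1\prec\cdots\prec m_\mu\}$. For $A\subseteq G(I)$, $\mathrm{lcm}(A)$ is the least common multiple of the elements of $A$ and $\min(A)$ its least element under $\prec$. A symbol is $u(i_1;\ldots;i_t)$ with $1\le i_1<\cdots<i_t\le\mu$; it is $L$-admissible (of dimension $t$) if for all $h<t$ and all $q<i_h$, $m_q$ does not divide $\mathrm{lcm}(m_{i_h},\ldots,m_{i_t})$. The Lyubeznik resolution of $R/I$ with respect to $\prec$ is the free resolution with $L^0=R$, $L^t$ the free $R$-module on the $L$-admissible symbols of dimension $t$, and $$\partial_t(u(i_1;\ldots;i_t))=\sum_{j=1}^t(-1)^{j+1}\frac{\mathrm{lcm}(m_{i_1},\ldots,m_{i_t})}{\mathrm{lcm}(m_{i_1},\ldots,\widehat{m_{i_j}},\ldots,m_{i_t})}\,u(i_1;\ldots;\widehat{i_j};\ldots;i_t).$$ $L_{\prec}(I)$ is the length of this resolution (largest $t$ with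 $L^t\neq0$), and $L(I)=\min\{L_{\prec}(I):\prec\text{ a total order on }G(I)\}$. $I$ is a Lyubeznik ideal if for some total order on $G(I)$ the Lyubeznik resolution is a minimal free resolution of $R/I$; $I$ is an almost Lyubeznik ideal if $L(I)=\mathrm{projdim}(R/I)$. A (nonempty) subset $D\subseteq G(I)$ is broken under $\prec$ if there is $u\in G(I)$ with $u\mid\mathrm{lcm}(D)$ and $u\prec\min(D)$. A subset $E\subseteq G(I)$ is preserved under $\prec$ if no subset of $E$ is broken. $ps(I,\prec)=\max\{|A|: A\subseteq G(I),\ A\text{ is preserved under }\prec\}$ and $ps(I)=\min\{ps(I,\prec):\prec\text{ is a total order on }G(I)\}$. *)

(* Defs.v *)
From HB Require Import structures.
From mathcomp Require Import all_boot all_order all_algebra.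
From mathcomp.multinomials Require Import mpoly.

Set Implicit Arguments.
Unset Strict Implicit.
Unset Printing Implicit Defensive.

Import GRing.Theory.

Local Open Scope ring_scope.
Local Open Scope quotient_scope.

Definition is_least (P : nat -> Prop) (k : nat) : Prop :=
  P k /\ forall j, P j -> (k <= j)%N.

Definition is_greatest (P : nat -> Prop) (k : nat) : Prop :=
  P k /\ forall j, P j -> (j <= k)%N.

Section QuotientModule.
Variables (R : nzRingType) (M : lmodType R).

(* Quotient.quot asks for closure under opposites, which SubmodClosed leaves
   implicit (it follows from closure under scaling by -1). *)
Definition zmod_of (N : submodClosed M) : {pred M} := fun x => x \in N.

Fact zmod_of_closed (N : submodClosed M) : zmod_closed (zmod_of N).
Proof.
split=> [|x y Nx Ny]; first exact: (rpred0 N).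
change (x - y \in N); rewrite -scaleN1r.
by apply: (rpredD Nx); apply: rpredZ.
Qed.

HB.instance Definition _ (N : submodClosed M) :=
  GRing.isZmodClosed.Build M (zmod_of N) (zmod_of_closed N).

Definition quotmod (N : submodClosed M) : Type := Quotient.quot (zmod_of N).

HB.instance Definition _ (N : submodClosed M) := GRing.Zmodule.on (quotmod N).

Variable N : submodClosed M.
Implicit Types (x y : M) (u v : quotmod N).

Definition quot_pi x : quotmod N := \pi_(Quotient.quot (zmod_of N)) x.

Definition quot_scale (a : R) u : quotmod N :=
  quot_pi (a *: repr (u : Quotient.quot (zmod_of N))).

Lemma quot_pi_eq x y : (quot_pi x == quot_pi y) = (x - y \in N).
Proof. by rewrite /quot_pi -Quotient.idealrBE. Qed.

Lemma quot_piK u : quot_pi (repr (u : Quotient.quot (zmod_of N))) = u.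
Proof. exact: reprK. Qed.

Lemma quot_piD x y : quot_pi (x + y) = quot_pi x + quot_pi y.
Proof. exact: Quotient.pi_add. Qed.

Lemma quot_piZ a x : quot_pi (a *: x) = quot_scale a (quot_pi x).
Proof.
apply/eqP; rewrite quot_pi_eq -scalerBr; apply: rpredZ.
by rewrite -quot_pi_eq quot_piK.
Qed.

Fact quot_scaleA a b u : quot_scale a (quot_scale b u) = quot_scale (a * b) u.
Proof. by rewrite -[u]quot_piK -!quot_piZ scalerA. Qed.

Fact quot_scale1 : left_id 1 quot_scale.
Proof. by move=> u; rewrite -[u]quot_piK -quot_piZ scale1r. Qed.

Fact quot_scaleDr : right_distributive quot_scale +%R.
Proof.
move=> a u v; rewrite -[u]quot_piK -[v]quot_piK.
by rewrite -quot_piD -!quot_piZ -quot_piD scalerDr.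
Qed.

Fact quot_scaleDl u : {morph quot_scale^~ u : a b / a + b}.
Proof.
by move=> a b; rewrite -[u]quot_piK -!quot_piZ -quot_piD scalerDl.
Qed.

HB.instance Definition _ := GRing.Zmodule_isLmodule.Build R (quotmod N)
  quot_scaleA quot_scale1 quot_scaleDr quot_scaleDl.

Fact quot_pi_linear : linear quot_pi.
Proof. by move=> a x y; rewrite quot_piD quot_piZ. Qed.

HB.instance Definition _ :=
  GRing.isLinear.Build R M (quotmod N) *:%R quot_pi quot_pi_linear.

End QuotientModule.

Section Resolutions.
Variable R : comNzRingType.

Definition surjective_map (A B : Type) (f : A -> B) : Prop :=
  forall y, exists x, f x = y.

Definition exact_at (A B C : lmodType R)
    (f : {linear A -> B}) (g : {linear B -> C}) : Prop :=
  forall y, g y = 0 <-> exists x, f x = y.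

Definition projective_module (P : lmodType R) : Prop :=
  forall (A B : lmodType R) (g : {linear A -> B}) (f : {linear P -> B}),
    surjective_map g -> exists h : {linear P -> A}, forall x, g (h x) = f x.

(* ... -> P 2 -> P 1 -> P 0 -> M -> 0, no condition yet on the P i *)
Definition is_resolution (M : lmodType R) (P : nat -> lmodType R)
    (d : forall i, {linear P i.+1 -> P i}) (eps : {linear P 0%N -> M}) : Prop :=
  [/\ surjective_map eps,
      exact_at (d 0%N) eps &
      forall i, exact_at (d i.+1) (d i)].

Definition has_projective_resolution (M : lmodType R) (l : nat) : Prop :=
  exists (P : nat -> lmodType R) (d : forall i, {linear P i.+1 -> P i})
         (eps : {linear P 0%N -> M}),
    [/\ is_resolution d eps,
        forall i, projective_module (P i) &
        forall i, (l < i)%N -> forall x : P i, x = 0].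

(* The zero module gets projective dimension 0. *)
Definition is_projdim (M : lmodType R) (k : nat) : Prop :=
  is_least (has_projective_resolution M) k.

Definition ideal_gen (r : seq R) (p : R) : Prop :=
  exists a : 'I_(size r) -> R, p = \sum_(i < size r) a i * r`_i.

Definition radical (J : R -> Prop) (p : R) : Prop := exists k : nat, J (p ^+ k).

(* Ideals of R are the submodules of the regular module R^o. *)
Definition is_ara (I : submodClosed R^o) (k : nat) : Prop :=
  is_least (fun m => exists r : m.-tuple R,
    forall p : R, radical (fun q => q \in I) p <-> radical (ideal_gen r) p) k.

End Resolutions.

Section Lyubeznik.
Variables (K : fieldType) (n : nat).
Local Notation R := {mpoly K[n]}.

Definition squarefree_monomial (m : 'X_{1..n}) : bool :=
  [forall i : 'I_n, (m i <= 1)%N].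

Definition monomials_generate (s : seq 'X_{1..n}) (I : submodClosed R^o) : Prop :=
  forall p : R, p \in I <-> ideal_gen [seq 'X_[K, m] | m <- s] p.

Definition squarefree_monomial_ideal (I : submodClosed R^o) : Prop :=
  exists s, all squarefree_monomial s /\ monomials_generate s I.

(* s lists without repetition the minimal monomial generating set G(I).  Such
   lists s = [:: m_1; ...; m_mu] stand for the total orders
   m_1 < ... < m_mu on G(I). *)
Definition ordered_min_gens (I : submodClosed R^o) (s : seq 'X_{1..n}) : Prop :=
  [/\ uniq s, monomials_generate s I &
      forall s', {subset s' <= s} -> monomials_generate s' I ->
        {subset s <= s'}].

Section Order.
Variable s : seq 'X_{1..n}.
Local Notation mu := (size s).
Local Notation gen := (tnth (in_tuple s)).

(* From here on a subset of G(I) is given by the set of its positions in s. *)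
Definition lcm_gens (D : {set 'I_mu}) : 'X_{1..n} :=
  \big[@mlcm n/0%MM]_(i in D) gen i.

(* The symbol u(i_1; ...; i_t) is the set {i_1, ..., i_t}; the condition on
   i = i_h with h < t is that D has an element beyond i. *)
Definition L_admissible (D : {set 'I_mu}) : bool :=
  [forall i in D, [exists j in D, (i < j)%N] ==>
    [forall q : 'I_mu, (q < i)%N ==>
      ~~ (gen q <= lcm_gens [set j in D | (i <= j)%N])%MM]].

Definition symbol (t : nat) : Type :=
  {D : {set 'I_mu} | L_admissible D && (#|D| == t)}.

HB.instance Definition _ t := Finite.on (symbol t).

Definition lyub_module (t : nat) : lmodType R := {ffun symbol t -> R^o}.

(* Coefficient of u(F) in the boundary of u(D).  When i = i_j in D, the number
   of elements of D below i is j - 1, which has the parity of j + 1. *)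
Definition lyub_coef (D F : {set 'I_mu}) : R :=
  \sum_(i in D | D :\ i == F)
    (-1) ^+ #|[set j in D | (j < i)%N]|
      * 'X_[K, (lcm_gens D - lcm_gens (D :\ i))%MM].

Definition lyub_diff (t : nat) (v : lyub_module t.+1) : lyub_module t :=
  [ffun F : symbol t =>
    \sum_(D : symbol t.+1) v D * lyub_coef (val D) (val F)].

Fact lyub_diff_linear t : linear (@lyub_diff t).
Proof.
move=> a v w; apply/ffunP=> F; rewrite !ffunE scaler_sumr -big_split /=.
by apply: eq_bigr => D _; rewrite !ffunE mulrDl scalerAl.
Qed.

HB.instance Definition _ t :=
  GRing.isLinear.Build R (lyub_module t.+1) (lyub_module t) *:%R
    (@lyub_diff t) (@lyub_diff_linear t).

Fact symbol0_proof : L_admissible set0 && (#|@set0 'I_mu| == 0%N).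
Proof. by rewrite cards0 eqxx andbT; apply/forall_inP=> i; rewrite inE. Qed.

Definition symbol0 : symbol 0 := Sub set0 symbol0_proof.

(* L^0 is free on the empty symbol, that is R up to isomorphism; the
   augmentation is the projection of R onto R/I. *)
Definition lyub_aug (I : submodClosed R^o) (v : lyub_module 0) : quotmod I :=
  quot_pi I (v symbol0).

Fact lyub_aug_linear I : linear (lyub_aug I).
Proof. by move=> a v w; rewrite /lyub_aug !ffunE linearP. Qed.

HB.instance Definition _ I :=
  GRing.isLinear.Build R (lyub_module 0) (quotmod I) *:%R
    (lyub_aug I) (lyub_aug_linear I).

Definition is_lyub_length (l : nat) : Prop :=
  is_greatest (fun t => exists v : lyub_module t, v <> 0) l.

(* Image of the differential inside (x_1, ..., x_n) L^t. *)
Definition lyub_minimal : Prop :=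
  forall t (v : lyub_module t.+1), exists w : 'I_n -> lyub_module t,
    lyub_diff v = \sum_(i < n) ('X_i : R) *: w i.

Definition lyub_is_minimal_free_resolution (I : submodClosed R^o) : Prop :=
  is_resolution (fun t => lyub_diff (t := t) : {linear _ -> _})
    (lyub_aug I : {linear _ -> _})
  /\ lyub_minimal.

Definition broken (D : {set 'I_mu}) : bool :=
  [exists d in D, [forall e in D, (d <= e)%N] &&
    [exists u : 'I_mu, (u < d)%N && (gen u <= lcm_gens D)%MM]].

Definition preserved (E : {set 'I_mu}) : bool :=
  [forall D : {set 'I_mu}, (D \subset E) ==> ~~ broken D].

Definition ps_order : nat := \max_(A : {set 'I_mu} | preserved A) #|A|.

End Order.

Definition is_L (I : submodClosed R^o) (k : nat) : Prop :=
  is_least (fun l => exists s, ordered_min_gens I s /\ is_lyub_length s l) k.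

Definition is_ps (I : submodClosed R^o) (k : nat) : Prop :=
  is_least (fun l => exists s, ordered_min_gens I s /\ ps_order s = l) k.

Definition lyubeznik_ideal (I : submodClosed R^o) : Prop :=
  exists s, ordered_min_gens I s /\ lyub_is_minimal_free_resolution s I.

Definition almost_lyubeznik_ideal (I : submodClosed R^o) : Prop :=
  exists k, is_L I k /\ is_projdim (quotmod I) k.

End Lyubeznik.

(* Main.v *)
Require Import Defs.
From HB Require Import structures.
From mathcomp Require Import all_boot all_order all_algebra.
From mathcomp.multinomials Require Import mpoly.
From mathcomp Require Import zify ring.
From Stdlib Require Import Classical ClassicalEpsilon.

(** Four numbers attached to a squarefree monomial ideal I of R = K[x_1,...,x_n]
    are compared through the chain

      pd(R/I) <= ara(I) <= L(I) = ps(I),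

    which holds for every such I; either hypothesis on I says that the two ends
    meet.  The almost Lyubeznik case is exactly L(I) = pd(R/I).  In the
    Lyubeznik case a minimal free resolution of length l is given; if a shorter
    projective resolution existed, the identity of its last module L^l would,
    up to homotopy, factor through the differential, forcing
    L^l = (x_1,...,x_n) L^l ([minimal_resolution_length]).  So l = pd(R/I), and
    l is the length of one Lyubeznik resolution, hence at least L(I).

    L(I) = ps(I).  Both count the same sets: D is L-admissible iff no final
    segment of D is broken, and a broken subset of D extends to a broken final
    segment ([preserved_admissible]).

    ara(I) <= L(I).  If every admissible set has at most l elements, I is the
    radical of the l sums g_k, for k = 1, ..., l, of the products of the
    generators over the admissible sets of size k.  Modulo the radical of
    (g_1, ..., g_l), and once the generators before m_j are known to vanish, the
    generating function of the g_k factors as (1 + T m_j) times another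
    polynomial; comparing coefficients gives m_j^(l+1) = 0
    ([admissible_sums_radical]).

    pd(R/I) <= ara(I).  Let I be the radical of (r_1, ..., r_m).  The simplicial
    bar complex F on the generators of I has a basis indexed by tuples of
    generators, graded by their lcm, and resolves R/I.  Let F^(q) be the same
    complex with all degrees multiplied by q.  The comparison map F^(q) -> F,
    which multiplies each basis vector by a monomial, can be compared with a
    composite F^(q) -> Kos(r_1^N, ..., r_m^N) -> F.  The second map exists as
    soon as r_i^N is in I.  The first exists for large q because the Koszul
    homology of powers is pro-zero in a Noetherian ring ([koszul_pro_exact],
    [koszul_chain_map]).  Both maps lift the projection onto R/I, hence are
    homotopic; since Kos vanishes above degree m, a homotopy h satisfies
    d f = d h d' in degree m+1.  Reading off multigraded coefficients turns
    this into a matrix identity E = E H E over K, where E is the matrix of the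
    differential.  The degrees being squarefree, deg u <= q deg t forces
    deg u <= deg t, so that H also defines a map F_m -> F_{m+1} over R; it
    splits the differential ([bar_splitting]) and F can be cut off at m
    ([truncated_projective_resolution]). *)

Set Implicit Arguments.
Unset Strict Implicit.
Unset Printing Implicit Defensive.

Import GRing.Theory.
Local Open Scope ring_scope.

(** * Linear maps, chain maps and homotopies *)

(** Chain maps and homotopies are built one degree at a time, each component
    depending on the previous one; P is the invariant that makes the next step
    possible and Q the relation imposed on consecutive components. *)
Lemma dependent_choice_seq (T : nat -> Type) (P : forall i, T i -> Prop)
    (Q : forall i, T i -> T i.+1 -> Prop) :
  (exists x, P 0%N x) ->
  (forall i x, P i x -> exists y, P i.+1 y /\ Q i x y) ->
  exists f : forall i, T i, forall i, P i (f i) /\ Q i (f i) (f i.+1).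
Proof.
move=> ex0 step.
pose S i := {x : T i | P i x}.
pose next i (s : S i) : S i.+1 :=
  let y := constructive_indefinite_description _ (step i (sval s) (svalP s)) in
  exist _ (sval y) (proj1 (svalP y)).
pose s0 : S 0%N := constructive_indefinite_description _ ex0.
pose s := nat_rect S s0 next.
exists (fun i => sval (s i)) => i; split; first exact: svalP (s i).
by rewrite /=; case: (constructive_indefinite_description _ _) => y [].
Qed.

Section LinearMaps.
Variable R : comNzRingType.

Definition linear_of (A B : lmodType R) (f : A -> B) (hf : linear f) :
  {linear A -> B} := HB.pack f (GRing.isLinear.Build R A B *:%R f hf).

Section Kernel.
Variables (A B : lmodType R) (f : {linear A -> B}).

Definition kernel_pred : {pred A} := fun x => f x == 0.

Fact kernel_submod_closed : submod_closed kernel_pred.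
Proof.
split=> [|a x y /eqP fx /eqP fy]; first by rewrite unfold_in linear0.
by rewrite unfold_in linearP fx fy scaler0 addr0.
Qed.

HB.instance Definition _ :=
  GRing.isSubmodClosed.Build R A kernel_pred
    (GRing.submod_closed_semi kernel_submod_closed).

Inductive kernel : predArgType := Kernel x & x \in kernel_pred.
Definition kernel_val u : A := let: Kernel x _ := u in x.

HB.instance Definition _ := [isSub of kernel for kernel_val].
HB.instance Definition _ := [Choice of kernel by <:].
HB.instance Definition _ := [SubChoice_isSubZmodule of kernel by <:].
HB.instance Definition _ := [SubZmodule_isSubLmodule of kernel by <:].

Lemma kernelP (u : kernel) : f (val u) = 0.
Proof. by apply/eqP; apply: (valP u). Qed.

Lemma kernel_valP : linear (val : kernel -> A).
Proof. by []. Qed.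

Definition kernel_inj : {linear kernel -> A} := linear_of kernel_valP.

Lemma kernel_lift (C : lmodType R) (g : {linear C -> A}) :
  (forall x, f (g x) = 0) -> exists h : {linear C -> kernel}, forall x, val (h x) = g x.
Proof.
move=> fg0.
have gK x : g x \in kernel_pred by rewrite unfold_in fg0.
pose h x := Kernel (gK x).
have hP : linear h by move=> a x y; apply: val_inj; rewrite /= linearP.
by exists (linear_of hP).
Qed.

End Kernel.

(** Only the image of u has to be reached by g: the surjection to lift along is
    the projection to P of the fibre product of u and g. *)
Lemma projective_lift (P A B : lmodType R) (g : {linear A -> B})
    (u : {linear P -> B}) :
  projective_module P -> (forall x, exists y, g y = u x) ->
  exists h : {linear P -> A}, forall x, g (h x) = u x.
Proof.
move=> projP gu.
have dP : linear (fun z : (P * A)%type => u z.1 - g z.2).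
  by move=> a y z; rewrite /= (linearP u) (linearP g) scalerBr opprD addrACA.
pose pb := kernel (linear_of dP).
have pP : linear (fun z : pb => (val z).1) by [].
have aP : linear (fun z : pb => (val z).2) by [].
have sp : surjective_map (linear_of pP).
  move=> x; have [y gy] := gu x.
  have yP : (x, y) \in kernel_pred (linear_of dP).
    by apply/eqP; rewrite /= gy subrr.
  by exists (Kernel yP).
have [s sP] := projP _ _ _ (idfun : {linear P -> P}) sp.
exists (linear_of aP \o s) => x /=.
have /eqP := kernelP (s x); rewrite /= subr_eq0 => /eqP <-.
by congr (u _); apply: sP.
Qed.

Lemma projective_retract (P Q : lmodType R) (i : {linear Q -> P})
    (p : {linear P -> Q}) :
  projective_module P -> (forall x, p (i x) = x) -> projective_module Q.
Proof.
move=> projP pi A B g f sg.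
have [h hP] := projP _ _ g (f \o p) sg.
by exists (h \o i) => x; rewrite /= hP /= pi.
Qed.

Lemma free_sumE (T : finType) (v : {ffun T -> R^o}) :
  v = \sum_t v t *: [ffun t' => (t' == t)%:R].
Proof.
apply/ffunP=> t; rewrite sum_ffunE (bigD1 t) //= !ffunE eqxx.
rewrite big1 ?addr0 => [|t' nt]; first by apply/esym/mulr1.
by rewrite !ffunE eq_sym (negbTE nt) scaler0.
Qed.

Lemma free_projective (T : finType) :
  projective_module ({ffun T -> R^o} : lmodType R).
Proof.
move=> A B g f sg.
pose e t : {ffun T -> R^o} := [ffun t' => (t' == t)%:R].
pose a t := sval (constructive_indefinite_description _ (sg (f (e t)))).
have aP t : g (a t) = f (e t).
  by rewrite /a; case: (constructive_indefinite_description _ _).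
have hP : linear (fun v : {ffun T -> R^o} => \sum_t v t *: a t).
  move=> c v w; rewrite scaler_sumr -big_split /=.
  by apply: eq_bigr => t _; rewrite !ffunE scalerDl scalerA.
exists (linear_of hP) => v /=; rewrite [in RHS](free_sumE v) !linear_sum.
by apply: eq_bigr => t _; rewrite !linearZ /= aP.
Qed.

Section Chains.
Variables (P G : nat -> lmodType R) (dP : forall i, {linear P i.+1 -> P i}).
Variables (dG : forall i, {linear G i.+1 -> G i}).
Variables (N : lmodType R) (eps : {linear G 0%N -> N}).
Hypothesis projP : forall i, projective_module (P i).
Hypothesis ddP : forall i x, dP i (dP i.+1 x) = 0.
Hypothesis resG : is_resolution dG eps.

Lemma chain_map_exists (a : {linear P 0%N -> N}) :
  (forall x, a (dP 0%N x) = 0) ->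
  exists f : forall i, {linear P i -> G i},
    (forall x, eps (f 0%N x) = a x) /\
    forall i x, dG i (f i.+1 x) = f i (dP i x).
Proof.
move=> ad0; have [seps ex0 exS] := resG.
(* Z i is the condition that exactness turns into a boundary: the cycles, or the
   kernel of the augmentation in degree 0. *)
pose Z i : (G i -> Prop) :=
  match i with 0 => fun y => eps y = 0 | j.+1 => fun y => dG j y = 0 end.
pose ok i (f : {linear P i -> G i}) :=
  (forall x, Z i (f (dP i x))) /\
  (match i return {linear P i -> G i} -> Prop with
   | 0 => fun f => forall x, eps (f x) = a x | _ => fun _ => True end f).
pose comm i (f : {linear P i -> G i}) (g : {linear P i.+1 -> G i.+1}) :=
  forall x, dG i (g x) = f (dP i x).
have exZ i y : Z i y -> exists x, dG i x = y.
  by case: i y => [|i] y /= Zy; [apply/ex0 | apply/exS].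
have [f fP] : exists f : forall i, {linear P i -> G i},
    forall i, ok i (f i) /\ comm i (f i) (f i.+1).
  apply: dependent_choice_seq => [|i f [Zf _]].
    have [f fP] := projective_lift (u := a) (@projP 0%N) (fun x => seps (a x)).
    by exists f; split=> [x|] //=; rewrite fP.
  have [g gP] := projective_lift (u := f \o dP i) (@projP i.+1)
    (fun x => exZ _ _ (Zf x)).
  by exists g; split=> //; split=> // x; rewrite /= gP /= ddP linear0.
exists f; split=> [x|i]; first by have [[_ /(_ x)]] := fP 0%N.
by have [] := fP i.
Qed.

(** Applied to the difference of two chain maps lifting the same map. *)
Lemma null_homotopy (f : forall i, {linear P i -> G i}) :
  (forall x, eps (f 0%N x) = 0) ->
  (forall i x, dG i (f i.+1 x) = f i (dP i x)) ->
  exists h : forall i, {linear P i -> G i.+1},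
    (forall x, f 0%N x = dG 0%N (h 0%N x)) /\
    forall i x, f i.+1 x = dG i.+1 (h i.+1 x) + h i (dP i x).
Proof.
move=> f0 fd; have [seps ex0 exS] := resG.
pose ok i (h : {linear P i -> G i.+1}) :=
  (forall x, dG i (h (dP i x)) = f i (dP i x)) /\
  (match i return {linear P i -> G i.+1} -> Prop with
   | 0 => fun h => forall x, f 0%N x = dG 0%N (h x) | _ => fun _ => True end h).
pose comm i (h : {linear P i -> G i.+1}) (k : {linear P i.+1 -> G i.+2}) :=
  forall x, f i.+1 x = dG i.+1 (k x) + h (dP i x).
have [h hP] : exists h : forall i, {linear P i -> G i.+1},
    forall i, ok i (h i) /\ comm i (h i) (h i.+1).
  apply: dependent_choice_seq => [|i h [dh _]].
    have [h hP] := projective_lift (g := dG 0%N) (u := f 0%N) (@projP 0%N)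
      (fun x => proj1 (ex0 _) (f0 x)).
    by exists h; split=> [x|] //=; rewrite hP.
  have cyc x : exists y, dG i.+1 y = (f i.+1 \- (h \o dP i)) x.
    by apply/exS; rewrite /= linearB /= fd dh subrr.
  have [k kP] := projective_lift (u := f i.+1 \- (h \o dP i)) (@projP i.+1) cyc.
  exists k; split=> [|x]; last by rewrite kP /= subrK.
  by split=> // x; rewrite kP /= ddP linear0 subr0.
exists h; split=> [x|i]; first by have [[_ /(_ x)]] := hP 0%N.
by have [] := hP i.
Qed.

End Chains.

Lemma resolution_dd (M : lmodType R) (F : nat -> lmodType R)
    (d : forall i, {linear F i.+1 -> F i}) (eps : {linear F 0%N -> M}) :
  is_resolution d eps -> forall i x, d i (d i.+1 x) = 0.
Proof. by move=> [_ _ ex] i x; apply/(ex i); exists x. Qed.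

Lemma resolution_ed (M : lmodType R) (F : nat -> lmodType R)
    (d : forall i, {linear F i.+1 -> F i}) (eps : {linear F 0%N -> M}) :
  is_resolution d eps -> forall x, eps (d 0%N x) = 0.
Proof. by move=> [_ ex _] x; apply/ex; exists x. Qed.

End LinearMaps.

(** * Cutting off a resolution, and minimal resolutions *)

Section Truncation.
Variables (R : comNzRingType) (M : lmodType R) (F : nat -> lmodType R).
Variables (d : forall i, {linear F i.+1 -> F i}) (eps : {linear F 0%N -> M}).
Variables (m : nat) (s : forall i, {linear F i -> F i.+1}).
Hypothesis resF : is_resolution d eps.
Hypothesis projF : forall i, projective_module (F i).
Hypothesis dsd : forall x, d m (s m (d m x)) = d m x.

Lemma dsd_at i : i = m -> forall x, d i (s i (d i x)) = d i x.
Proof. by move=> ->. Qed.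

(** The truncated complex is cut out of F as the kernels of these idempotents:
    everything below degree m, a complement of the boundaries in degree m, zero
    above.  Kernels in every degree avoid modules defined by cases on the degree. *)
Definition trunc_fun i (x : F i) : F i :=
  if (i < m)%N then 0 else if i == m then d i (s i x) else x.

Fact trunc_fun_linear i : linear (@trunc_fun i).
Proof.
move=> a x y; rewrite /trunc_fun; case: ifP => _.
  by rewrite scaler0 addr0.
by case: ifP => // _; rewrite !linearP.
Qed.

Definition trunc i : {linear F i -> F i} := linear_of (@trunc_fun_linear i).

Lemma trunc_idem i x : trunc i (trunc i x) = trunc i x.
Proof.
rewrite /= /trunc_fun; case: ltngtP => // im.
by rewrite dsd_at.
Qed.

Lemma trunc_above i x : (m < i)%N -> trunc i x = x.
Proof. by move=> im; rewrite /= /trunc_fun; case: ltngtP im. Qed.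

Lemma trunc_d_closed i x : trunc i.+1 x = 0 -> trunc i (d i x) = 0.
Proof.
case: (ltnP i m) => im tx; first by rewrite /= /trunc_fun im.
by rewrite -(trunc_above x) ?ltnS // tx !linear0.
Qed.

Lemma d_trunc i z : trunc i (d i z) = 0 -> d i (trunc i.+1 z) = 0.
Proof.
move=> tdz; rewrite /= /trunc_fun; case: (ltngtP i.+1 m) => im.
- by rewrite linear0.
- rewrite ltnS leq_eqVlt in im; case/orP: im => [/eqP im | im].
    have im' : i = m by rewrite im.
    have [im0 im1] : (i < m)%N = false /\ (i == m) by rewrite im' ltnn eqxx.
    by move: tdz; rewrite /= /trunc_fun im0 im1 dsd_at.
  by rewrite -(trunc_above (d i z)).
- exact: resolution_dd resF _ _.
Qed.

Lemma eps_trunc x : eps (trunc 0%N x) = 0.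
Proof.
rewrite /= /trunc_fun; case: ltngtP => // im; first by rewrite linear0.
exact: resolution_ed resF _.
Qed.

(** If d s d = d in degree m, then d s projects F m onto the boundaries, so
    F m modulo the boundaries is a direct summand of F m and may end the
    resolution. *)
Lemma truncated_projective_resolution : has_projective_resolution M m.
Proof.
have [seps ex0 exS] := resF.
pose P i : lmodType R := kernel (trunc i).
have dk i (x : P i.+1) : trunc i ((d i \o kernel_inj (trunc i.+1)) x) = 0.
  exact: trunc_d_closed (kernelP x).
pose dP i := sval (constructive_indefinite_description _ (kernel_lift (@dk i))).
have dPE i (x : P i.+1) : val (dP i x) = d i (val x).
  by rewrite /dP; case: (constructive_indefinite_description _ _).
have tB i (x : F i) : trunc i (x - trunc i x) = 0.
  by rewrite linearB trunc_idem subrr.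
have kP i (x : F i) : x - trunc i x \in kernel_pred (trunc i).
  by rewrite unfold_in tB.
have lift i (y : P i) (z : F i.+1) : d i z = val y -> exists x, dP i x = y.
  move=> dz; exists (Kernel (kP _ z)); apply: val_inj; rewrite dPE /= linearB.
  by rewrite d_trunc ?subr0 ?dz //; apply: kernelP.
exists P, dP, (eps \o kernel_inj (trunc 0%N)); split=> [|i|i im x].
- split=> [v|y|i y].
  + have [x epsx] := seps v; exists (Kernel (kP _ x)).
    by rewrite /= linearB eps_trunc subr0.
  + split=> [/ex0 [z]|[x <-]]; first exact: lift.
    by rewrite /= -[kernel_val _]/(val _) dPE; apply: resolution_ed resF _.
  + split=> [dy|[x <-]].
      have /exS [z] : d i (val y) = 0 by rewrite -dPE dy.
      exact: lift.
    apply: val_inj; rewrite !dPE; exact: resolution_dd resF _ _.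
- have qP : linear (fun x : F i => Kernel (kP _ x) : P i).
    move=> a x y; apply: val_inj; rewrite /=.
    have /= -> := linearP (trunc i) a x y; by rewrite scalerBr opprD addrACA.
  apply: (@projective_retract _ _ _ (kernel_inj (trunc i)) (linear_of qP)) => //.
  move=> x; apply: val_inj; rewrite /= -[kernel_val _]/(val _).
  by have := kernelP x; rewrite /= => ->; rewrite subr0.
- by apply: val_inj; rewrite -[LHS](trunc_above _ im) kernelP.
Qed.

End Truncation.

(** Composing comparison maps through a resolution of length j < l gives a chain
    endomorphism of F homotopic to the identity and zero in degree l.  There the
    homotopy reads x = h (d x) up to sign, and d x is divisible by the a k. *)
Lemma minimal_resolution_length (R : comNzRingType) (M : lmodType R)
    (F : nat -> lmodType R) (d : forall i, {linear F i.+1 -> F i})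
    (eps : {linear F 0%N -> M}) (n : nat) (a : 'I_n -> R) (l j : nat) :
  is_resolution d eps -> (forall i, projective_module (F i)) ->
  (forall x : F l.+1, x = 0) ->
  (forall i (v : F i.+1), exists w : 'I_n -> F i, d i v = \sum_k a k *: w k) ->
  has_projective_resolution M j -> (j < l)%N ->
  forall x : F l, exists w : 'I_n -> F l, x = \sum_k a k *: w k.
Proof.
move=> resF projF F0 minF [P [dP [epsP [resP projP P0]]]] jl.
have [f [f0 fd]] := chain_map_exists projF (resolution_dd resF) resP
  (resolution_ed resF).
have [g [g0 gd]] := chain_map_exists projP (resolution_dd resP) resF
  (resolution_ed resP).
have [|i x|h [_ hS]] := null_homotopy projF (resolution_dd resF) resF
  (f := fun i => idfun \- (g i \o f i)).
- by move=> x; rewrite /= linearB /= g0 f0 subrr.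
- by rewrite /= linearB /= gd fd.
case: l jl F0 => // l jl F0 x.
have := hS l x; rewrite /= (P0 _ jl (f l.+1 x)) linear0 subr0.
rewrite (F0 (h l.+1 x)) linear0 add0r => ->.
have [w ->] := minF l x; exists (fun k => h l (w k)).
by rewrite linear_sum; apply: eq_bigr => k _; rewrite linearZ.
Qed.

(** * The ascending chain condition in polynomial rings *)

Section Noetherian.

(** Repeatedly take an index at which the remaining tail of g is minimal. *)
Lemma monotone_subsequence (g : nat -> nat) :
  exists phi : nat -> nat, {homo phi : i j / (i < j)%N} /\
    {homo g \o phi : i j / (i <= j)%N}.
Proof.
have argmin a : exists b, (a <= b)%N /\ forall c, (a <= c)%N -> (g b <= g c)%N.
  apply: NNPP => no; suff: forall v b, (a <= b)%N -> (v <= g b)%N.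
    by move=> /(_ (g a).+1 a (leqnn a)); rewrite ltnn.
  elim=> // v IHv b ab; rewrite ltn_neqAle IHv // andbT.
  apply/eqP => vb; case: no; exists b; split=> // c ac.
  by rewrite -vb IHv.
pose m a := sval (constructive_indefinite_description _ (argmin a)).
have mP a : (a <= m a)%N /\ forall c, (a <= c)%N -> (g (m a) <= g c)%N.
  by rewrite /m; case: (constructive_indefinite_description _ _).
pose phi k := iter k (fun b => m b.+1) (m 0%N).
have phiS k : (phi k < phi k.+1)%N by have [] := mP (phi k).+1.
exists phi; split; first exact: homo_ltn ltn_trans phiS.
apply: homo_leq leqnn leq_trans _ => k /=.
have phimin : exists a, phi k = m a by case: k => [|k]; eexists.
have [a phik] := phimin; rewrite {1}phik.
by apply: (proj2 (mP a)); apply: leq_trans (ltnW (phiS k)); rewrite phik; case: (mP a).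
Qed.

Lemma dickson n (f : nat -> 'X_{1..n}) :
  exists i j, (i < j)%N /\ (f i <= f j)%MM.
Proof.
suff [phi [phi_lt fphi]] : exists phi : nat -> nat,
    {homo phi : i j / (i < j)%N} /\
    forall k, k \in enum 'I_n -> {homo (fun i => f (phi i) k) : i j / (i <= j)%N}.
  exists (phi 0%N), (phi 1%N); split; first exact: phi_lt.
  by apply/mnm_lepP => k; apply: fphi; rewrite ?mem_enum.
elim: (enum _) => [|k s [phi [phi_lt fphi]]]; first by exists id; split.
have [psi [psi_lt fpsi]] := monotone_subsequence (fun i => f (phi i) k).
exists (phi \o psi); split=> [i j ij|l]; first exact/phi_lt/psi_lt.
rewrite inE => /orP[/eqP -> //|ls i j ij] /=.
by apply: fphi => //; apply: (homo_leq leqnn leq_trans) ij => r; apply/ltnW/psi_lt.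
Qed.

Variables (K : fieldType) (n : nat).
Local Notation R := {mpoly K[n]}.

(** In a strictly growing chain choose at each stage a new element with the
    smallest possible leading monomial.  By Dickson one of these leading monomials
    divides that of a later element, which can then be reduced to a smaller new
    element. *)
Lemma mpoly_acc (J : nat -> R -> Prop) :
  (forall k a b p, J k a -> J k b -> J k (a - p * b)) ->
  (forall k, J k 0) -> (forall k a, J k a -> J k.+1 a) ->
  exists c, forall k a, J k a -> J c a.
Proof.
move=> Jideal J0 Jinc; apply: NNPP => no.
have Jmono k l a : (k <= l)%N -> J k a -> J l a.
  by move=> /subnK <-; elim: (l - k)%N => // i IHi /IHi /Jinc.
pose new c a := (exists k, J k a) /\ ~ J c a.
have has_new c : exists a, new c a /\ forall b, new c b -> ~ (mlead b < mlead a)%O.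
  apply: NNPP => nomin.
  have none : forall m a, mlead a = m -> ~ new c a.
    apply: ltmwf => m IHm a am new_a; apply: nomin; exists a; split=> // b new_b ba.
    by apply: (IHm (mlead b)) (erefl _) new_b; rewrite -am.
  apply: no; exists c => k a Jka; apply: NNPP => nJa.
  by apply: (none _ a (erefl _)); split=> //; exists k.
pose a c := sval (constructive_indefinite_description _ (has_new c)).
have aP c : new c (a c) /\ forall b, new c b -> ~ (mlead b < mlead (a c))%O.
  by rewrite /a; case: (constructive_indefinite_description _ _).
have has_next c : exists k, J k (a c) by have [[]] := aP c.
pose next c := sval (constructive_indefinite_description _ (has_next c)).
have nextP c : J (next c) (a c).
  by rewrite /next; case: (constructive_indefinite_description _ _).
have lt_next c : (c < next c)%N.
  rewrite ltnNge; apply/negP => nc; have [[_ nJ] _] := aP c.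
  exact/nJ/(Jmono _ _ _ nc).
pose c k := iter k next 0%N.
have [i [j [ij le_ij]]] := dickson (fun k => mlead (a (c k))).
have Ji : J (c j) (a (c i)).
  apply: Jmono (nextP (c i)).
  have c_lt : {homo c : x y / (x < y)%N} by apply: homo_ltn ltn_trans _ => x /=.
  by apply: (homo_leq leqnn leq_trans (fun x => ltnW (c_lt _ _ (ltnSn x)))) ij.
have [[[k Jk] nJ] minj] := aP (c j).
set ai := a (c i) in le_ij Ji; set aj := a (c j) in le_ij Jk nJ minj.
have ai0 : ai != 0.
  by apply/eqP => ai0; have [[_ nJi] _] := aP (c i); apply: nJi; rewrite -/ai ai0.
have aj0 : aj != 0 by apply/eqP => aj0; apply: nJ; rewrite aj0.
(* The multiple of ai that cancels the leading term of aj. *)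
pose p := (mleadc aj / mleadc ai) *: 'X_[K, (mlead aj - mlead ai)%MM].
have lc0 : mleadc aj / mleadc ai != 0.
  by rewrite mulf_neq0 ?invr_eq0 ?mleadc_eq0.
have p0 : p != 0.
  by rewrite -mleadc_eq0 /p mleadZ // mleadXm mcoeffZ mcoeffX eqxx mulr1.
have lead_p : mlead (p * ai) = mlead aj.
  by rewrite mleadM // /p mleadZ // mleadXm submK.
pose b := aj - p * ai.
have nJb : ~ J (c j) b.
  move=> Jb; apply: nJ.
  have -> : aj = b - (- p) * ai by rewrite /b mulNr opprK subrK.
  exact: Jideal.
have b0 : b != 0 by apply/eqP => b0; apply: nJb; rewrite b0.
apply: (minj b).
  split=> //; exists (maxn k (c j)); apply: Jideal; first exact: Jmono (leq_maxl _ _) Jk.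
  exact: Jmono (leq_maxr _ _) Ji.
rewrite Order.POrderTheory.lt_neqAle; apply/andP; split.
  apply: contra_neq b0 => lead_b; apply/eqP; rewrite -mleadc_eq0 lead_b.
  rewrite mcoeffB /p -scalerAl mcoeffZ [_ * ai]mulrC.
  have := mcoeffMX ai (mlead aj - mlead ai)%MM (mlead ai); rewrite submK // => ->.
  by rewrite divfK ?subrr ?mleadc_eq0.
by have := mleadB_le aj (p * ai); rewrite lead_p Order.JoinTheory.joinxx.
Qed.

End Noetherian.
(** * Koszul complexes of powers *)

Section Koszul.
Variable R : comNzRingType.
Implicit Types (rs : seq R).

Definition zero_module : lmodType R := {ffun void -> R^o}.

Lemma zero_moduleP (x : zero_module) : x = 0.
Proof. by apply/ffunP; case. Qed.

Definition shift_module (F : nat -> lmodType R) i : lmodType R :=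
  if i is j.+1 then F j else R^o.

(** The Koszul complex on r :: rs is the mapping cone of multiplication by a power
    of r on the Koszul complex on rs.  The modules do not depend on the power, and
    degree 0 is kept definitionally equal to R by shifting degrees by one. *)
Fixpoint koszulS rs i : lmodType R :=
  match rs with
  | [::] => zero_module
  | _ :: rs' => (koszulS rs' i * shift_module (koszulS rs') i)%type
  end.

Definition koszul rs : nat -> lmodType R := shift_module (koszulS rs).

Fixpoint koszul_fun (N : nat) rs i {struct rs} : koszul rs i.+1 -> koszul rs i :=
  match rs, i return koszul rs i.+1 -> koszul rs i with
  | [::], _ => fun _ => 0
  | r :: rs', 0 => fun z => @koszul_fun N rs' 0 z.1 + r ^+ N *: z.2
  | r :: rs', j.+1 => fun z =>
      (@koszul_fun N rs' j.+1 z.1 + r ^+ N *: z.2, - @koszul_fun N rs' j z.2)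
  end.

Fact koszul_fun_linear N rs i : linear (@koszul_fun N rs i).
Proof.
have reorder (V : lmodType R) (x1 x2 y1 y2 : V) (a b : R) :
    a *: x1 + x2 + b *: (a *: y1 + y2) = a *: (x1 + b *: y1) + (x2 + b *: y2).
  by rewrite !scalerDr !scalerA [b * a]mulrC addrACA.
elim: rs i => [|r rs IH] i a x y /=.
  by case: i x y => [|i] x y /=; rewrite scaler0 addr0.
case: i x y => [|i] x y /=; first by rewrite IH; apply: reorder.
by congr (_, _); rewrite IH ?opprD /= ?scalerN //; apply: reorder.
Qed.

HB.instance Definition _ N rs i :=
  GRing.isLinear.Build R (koszul rs i.+1) (koszul rs i) *:%R
    (@koszul_fun N rs i) (@koszul_fun_linear N rs i).

(** The transition map from the complex on the powers r^(N+c) to the one on the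
    powers r^N: it multiplies the basis vector of a subset by the c-th powers of
    its members. *)
Fixpoint koszul_pow (c : nat) rs i {struct rs} : koszul rs i -> koszul rs i :=
  match rs return koszul rs i -> koszul rs i with
  | [::] => id
  | r :: rs' =>
    match i return koszul (r :: rs') i -> koszul (r :: rs') i with
    | 0 => id
    | j.+1 => fun z => (@koszul_pow c rs' j.+1 z.1, r ^+ c *: @koszul_pow c rs' j z.2)
    end
  end.

Fact koszul_pow_linear c rs i : linear (@koszul_pow c rs i).
Proof.
elim: rs i => [|r rs IH] i a x y //=; case: i x y => [|i] x y //=.
by congr (_, _); rewrite IH //= scalerDr !scalerA [_ * a]mulrC.
Qed.

HB.instance Definition _ c rs i :=
  GRing.isLinear.Build R (koszul rs i) (koszul rs i) *:%R
    (@koszul_pow c rs i) (@koszul_pow_linear c rs i).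

Lemma koszul_pow0 c rs (x : koszul rs 0) : koszul_pow c x = x.
Proof. by case: rs x. Qed.

Lemma koszul_powD a b rs i (x : koszul rs i) :
  koszul_pow a (koszul_pow b x) = koszul_pow (a + b) x.
Proof.
elim: rs i x => [|r rs IH] i x //=; case: i x => [|i] x //=.
by rewrite linearZ /= !IH scalerA -exprD.
Qed.

Lemma koszul_fun_pow N c rs i (x : koszul rs i.+1) :
  koszul_fun N (koszul_pow c x) = koszul_pow c (koszul_fun (N + c) x).
Proof.
elim: rs i x => [|r rs IH] i x /=; first by case: i x.
case: i x => [|i] x /=; first by rewrite IH !koszul_pow0 scalerA -exprD.
by rewrite linearD linearN !linearZ /= !IH scalerN scalerA -exprD [(c + N)%N]addnC.
Qed.

Lemma koszul_funK N rs i (x : koszul rs i.+2) : koszul_fun N (koszul_fun N x) = 0.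
Proof.
have cancel (V : lmodType R) (a : R) (v : V) : a *: v + a *: - v = 0.
  by rewrite scalerN addrN.
elim: rs i x => [|r rs IH] i x //=.
case: i x => [|i] x /=; first by rewrite linearD linearZ /= IH add0r; apply: cancel.
rewrite linearD linearZ /= !IH add0r; congr (_, _); first exact: cancel.
by rewrite linearN /= IH !oppr0.
Qed.

Lemma koszul_eq0 rs i (x : koszul rs i) : (size rs < i)%N -> x = 0.
Proof.
elim: rs i x => [|r rs IH] [|i] //= x; first by move=> _; apply: zero_moduleP.
case: x => a b; rewrite ltnS => le_i.
by congr (_, _); [apply: (IH i.+1) (ltnW _) | apply: (IH i)].
Qed.

Lemma koszul_im0P N rs (p : R) :
  (exists x : koszul rs 1, koszul_fun N x = p) <-> ideal_gen [seq r ^+ N | r <- rs] p.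
Proof.
elim: rs p => [|r rs IH] p /=.
  split=> [[x <-]|[a ->]]; last by exists 0; rewrite big_ord0.
  by exists (fun _ => 0); rewrite big_ord0.
split=> [[[x b] /= <-]|[a ->]].
  have /IH [a ->] : exists y : koszul rs 1, koszul_fun N y = koszul_fun N x by exists x.
  exists (fun i => if unlift ord0 i is Some j then a j else b).
  rewrite big_ord_recl unlift_none addrC mulrC; congr (_ + _).
  by apply: eq_bigr => i _; rewrite liftK.
have /IH [x xE] : ideal_gen [seq r ^+ N | r <- rs]
    (\sum_(i < size [seq r ^+ N | r <- rs]) a (lift ord0 i) * [seq r ^+ N | r <- rs]`_i).
  by exists (fun i => a (lift ord0 i)).
by exists (x, a ord0); rewrite /= xE big_ord_recl addrC [a ord0 * _]mulrC.
Qed.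

(** What the Noetherian property of R contributes to pro-exactness. *)
Definition colon_stabilizes : Prop :=
  forall J : R -> Prop, J 0 -> (forall a b p, J a -> J b -> J (a - p * b)) ->
  forall r, exists c, forall k b, J (r ^+ k * b) -> J (r ^+ c * b).

Hypothesis colonR : colon_stabilizes.

(** Induction on the mapping cone.  For a cycle (a, b) of the cone, b is handled by
    the induction hypothesis in positive degree and by stabilization of colon
    ideals in degree 0; subtracting a boundary leaves a cycle with b = 0, to which
    the induction hypothesis applies again. *)
Lemma koszul_pro_exact rs N : exists c, forall i (x : koszul rs i.+1),
  koszul_fun (N + c) x = 0 -> exists y : koszul rs i.+2, koszul_fun N y = koszul_pow c x.
Proof.
elim: rs N => [|r rs IH] N.
  by exists 0%N => i x _; exists 0; rewrite linear0; apply/esym/zero_moduleP.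
have [c1 IH1] := IH N; have [c2a IH2] := IH (N + c1)%N.
pose J p := exists x : koszul rs 1, koszul_fun (N + c1) x = p.
have J0 : J 0 by exists 0; rewrite linear0.
have JB a b p : J a -> J b -> J (a - p * b).
  by case=> x <- [y <-]; exists (x - p *: y); rewrite linearB linearZ.
have [c2b colonJ] := colonR J0 JB r.
set N1 := (N + c1)%N in IH2 J J0 JB colonJ *.
(* c2a serves b in positive degree, c2b in degree 0; c1 serves the remaining
   cycle. *)
pose c2 := (c2a + c2b)%N.
have lift_b i (a : koszul rs i.+1) (b : koszul rs i) :
    koszul_fun (rs := r :: rs) (N1 + c2) ((a, b) : koszul (r :: rs) i.+1) = 0 ->
    koszul_fun (N1 + c2) a + r ^+ (N1 + c2) *: b = 0 /\
    exists b' : koszul rs i.+1, koszul_fun N1 b' = r ^+ c2 *: koszul_pow c2 b.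
  case: i a b => [|i] a b /=.
    move=> dab; split=> //.
    have [|x xE] := colonJ (N1 + c2)%N b.
      exists (- koszul_pow c2 a); rewrite linearN /= koszul_fun_pow koszul_pow0.
      by apply/eqP; rewrite eqr_oppLR -addr_eq0; apply/eqP.
    exists (r ^+ c2a *: x); rewrite linearZ /= xE koszul_pow0.
    by rewrite exprD -scalerA.
  move=> dab; have [da /eqP] := (congr1 fst dab, congr1 snd dab).
  rewrite /= oppr_eq0 => /eqP db; split=> //.
  have [|y yE] := IH2 _ (koszul_pow c2b b).
    by rewrite koszul_fun_pow -addnA db linear0.
  by exists (r ^+ c2 *: y); rewrite linearZ /= yE koszul_powD.
exists (c1 + c2)%N => i x; move: (x.1 : koszul rs i.+1) (x.2 : koszul rs i)
  (surjective_pairing x) => a b ->{x} dab.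
rewrite addnA in dab; have [da [b' db']] := lift_b i a b dab.
have [|a2 da2] := IH1 _ (koszul_pow c2 a + r ^+ N1 *: b').
  rewrite linearD linearZ /= koszul_fun_pow db' scalerA -exprD -/N1.
  by rewrite -linearZ -linearD /= da linear0.
exists (a2, - (r ^+ c1 *: koszul_pow c1 b')) => /=.
congr (_, _).
  by rewrite da2 linearD linearZ /= koszul_powD scalerN scalerA -exprD addrK.
rewrite linearN linearZ /= opprK koszul_fun_pow db' linearZ /= koszul_powD.
by rewrite scalerA -exprD.
Qed.

End Koszul.

Section KoszulChainMap.
Variable R : comNzRingType.
Hypothesis colonR : colon_stabilizes R.

(** Each lifting step costs one application of pro-exactness and lowers the power
    by one level.  As the Koszul complex is zero above degree size rs, finitely
    many levels suffice, and all components are pushed to the level N at the end. *)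
Lemma koszul_chain_map (rs : seq R) N : exists N', (N <= N')%N /\
  forall (P : nat -> lmodType R) (dP : forall i, {linear P i.+1 -> P i})
    (a : {linear P 0%N -> R^o}),
  (forall i, projective_module (P i)) -> (forall i x, dP i (dP i.+1 x) = 0) ->
  (forall x, ideal_gen [seq r ^+ N' | r <- rs] (a (dP 0%N x))) ->
  exists f : forall i, {linear P i -> koszul rs i},
    (forall x, f 0%N x = a x) /\
    forall i x, koszul_fun N (f i.+1 x) = f i (dP i x).
Proof.
pose c N := sval (constructive_indefinite_description _ (koszul_pro_exact colonR rs N)).
have cP M i (x : koszul rs i.+1) : koszul_fun (M + c M) x = 0 ->
    exists y : koszul rs i.+2, koszul_fun M y = koszul_pow (c M) x.
  by rewrite /c; case: (constructive_indefinite_description _ _) => e /= He; apply: He.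
(* Degree i lives at level S - i: the start is at level S, and from degree S on
   the Koszul complex is zero. *)
pose level k := iter k (fun M => M + c M)%N N.
have le_level k : (N <= level k)%N.
  by elim: k => // k IHk; apply: leq_trans IHk (leq_addr _ _).
pose S := (size rs).+1; pose L i := level (S - i)%N.
have LS i : (i < S)%N -> L i = (L i.+1 + c (L i.+1))%N.
  by move=> iS; rewrite /L subnS; case: (S - i)%N (subn_gt0 i S) => [|k //]; rewrite iS.
have L_top i : (S <= i)%N -> L i = L i.+1.
  by move=> Si; rewrite /L subnS (eqP Si).
have L_mono i : (L i.+1 <= L i)%N.
  by case: (ltnP i S) => [/LS ->|/L_top ->//]; apply: leq_addr.
exists (level S); split=> // P dP a projP ddP ada.
pose ok i (f : {linear P i -> koszul rs i}) :=
  (forall x, exists y, koszul_fun (L i.+1) y = koszul_pow (L i - L i.+1) (f (dP i x))) /\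
  (match i return {linear P i -> koszul rs i} -> Prop with
   | 0 => fun f => forall x, f x = a x | _ => fun _ => True end f).
pose comm i (f : {linear P i -> koszul rs i}) (g : {linear P i.+1 -> koszul rs i.+1}) :=
  forall x, koszul_fun (L i.+1) (g x) = koszul_pow (L i - L i.+1) (f (dP i x)).
have [f fP] : exists f : forall i, {linear P i -> koszul rs i},
    forall i, ok i (f i) /\ comm i (f i) (f i.+1).
  apply: dependent_choice_seq => [|i f [fex _]].
    exists a; split=> // x; have /koszul_im0P [y yE] := ada x.
    exists (koszul_pow (L 0%N - L 1%N) y).
    by rewrite koszul_fun_pow subnKC // yE.
  have [g gP] := projective_lift (g := @koszul_fun R (L i.+1) rs i)
    (u := @koszul_pow R (L i - L i.+1) rs i \o (f \o dP i)) (@projP i.+1) fex.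
  exists g; split=> //; split=> // x.
  case: (ltnP i.+1 S) => [iS|Si]; last first.
    exists 0; rewrite linear0; have -> : g (dP i.+1 x) = 0 by apply: koszul_eq0.
    by rewrite linear0.
  rewrite [L i.+1]LS // addKn; apply: cP; rewrite -LS // gP /= ddP.
  by rewrite !linear0.
exists (fun i => @koszul_pow R (L i - N) rs i \o f i); split=> [x|i x] /=.
  by rewrite koszul_pow0; have [[_ /(_ x)]] := fP 0%N.
have [_ fcomm] := fP i; rewrite koszul_fun_pow (subnKC (le_level _)) fcomm.
rewrite koszul_powD addnC addnBA; last exact: le_level.
by rewrite subnK.
Qed.

End KoszulChainMap.

(** * Multigraded maps of free modules *)

Section GradedMaps.
Variables (K : fieldType) (n : nat).
Local Notation R := {mpoly K[n]}.
Local Notation mon := 'X_{1..n}.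

Lemma mcoeffMX_nle (p : R) (m k : mon) : ~~ (m <= k)%MM -> (p * 'X_[m])@_k = 0.
Proof.
move=> nmk; apply: memN_msupp_eq0; apply: contra nmk.
by rewrite (perm_mem (msuppMX p m)) => /mapP[m' _ ->]; apply: lem_addr.
Qed.

(** The product of the row vector y by the matrix A. *)
Definition act (T U : finType) (y : T -> K) (A : T -> U -> K) (u : U) : K :=
  \sum_t y t * A t u.

Lemma actA (T U W : finType) (y : T -> K) (A : T -> U -> K) (B : U -> W -> K) w :
  act (act y A) B w = act y (fun t => act (A t) B) w.
Proof.
rewrite /act; under eq_bigr do rewrite mulr_suml.
rewrite exchange_big; apply: eq_bigr => t _; rewrite mulr_sumr.
by apply: eq_bigr => u _; rewrite mulrA.
Qed.

Lemma eq_act (T U : finType) (y y' : T -> K) (A A' : T -> U -> K) u :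
  y =1 y' -> (forall t, A t u = A' t u) -> act y A u = act y' A' u.
Proof. by move=> yy AA; apply: eq_bigr => t _; rewrite yy AA. Qed.

Lemma act_delta (T U : finType) (A : T -> U -> K) t u :
  act (fun t' => (t' == t)%:R) A u = A t u.
Proof.
rewrite /act (bigD1 t) //= eqxx mul1r big1 ?addr0 // => t' /negbTE ->.
by rewrite mul0r.
Qed.

Section Strands.
Variables (T : finType) (a : T -> mon).

(** The part of v of multidegree c, a vector over K: basis vector t, of degree
    a t, contributes the coefficient of the monomial c - a t. *)
Definition strand (v : {ffun T -> R^o}) (c : mon) (t : T) : K :=
  if (a t <= c)%MM then (v t : R)@_(c - a t) else 0.

Lemma strand_neq0 v c t : strand v c t != 0 -> (a t <= c)%MM.
Proof. by rewrite /strand; case: ifP => //; rewrite eqxx. Qed.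

Lemma strand_inj v w : (forall c t, strand v c t = strand w c t) -> v = w.
Proof.
move=> vw; apply/ffunP => t; apply/mpolyP => m.
by have := vw (m + a t)%MM t; rewrite /strand lem_addl addmK.
Qed.

Lemma strand_sum (I : finType) (v : I -> {ffun T -> R^o}) c t :
  strand (\sum_i v i) c t = \sum_i strand (v i) c t.
Proof.
rewrite /strand; case: ifP => _; last by rewrite big1.
by rewrite sum_ffunE raddf_sum.
Qed.

Lemma strandX k (m : mon) v c t : (m <= c)%MM ->
  strand ((k *: 'X_[m] : R) *: v) c t = k * strand v (c - m)%MM t.
Proof.
move=> mc; rewrite /strand !ffunE.
have -> : (k *: 'X_[m] : R) *: v t = k *: ((v t : R) * 'X_[m]).
  by rewrite [LHS](_ : _ = (k *: 'X_[m] : R) * (v t : R)) // -scalerAl mulrC.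
have [atc|natc] := boolP (a t <= c - m)%MM.
  have le_sum : (a t + m <= c)%MM.
    apply/mnm_lepP => i; move/mnm_lepP/(_ i): atc; move/mnm_lepP/(_ i): mc.
    rewrite mnmDE mnmBE; lia.
  have -> : (a t <= c)%MM by apply: lepm_trans le_sum; apply: lem_addr.
  have -> : (c - a t = m + (c - m - a t))%MM.
    apply/mnmP => i; move/mnm_lepP/(_ i): le_sum.
    rewrite !(mnmDE, mnmBE) => le_i; lia.
  by rewrite mcoeffZ mcoeffMX.
case: ifP => [atc|]; last by rewrite mulr0.
rewrite mcoeffZ mcoeffMX_nle //; apply: contra natc => /mnm_lepP le_m.
apply/mnm_lepP => i; move/mnm_lepP/(_ i): atc; move: (le_m i).
move/mnm_lepP/(_ i): mc; rewrite !mnmBE; lia.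
Qed.

Lemma strand_finite v : exists B : seq mon, forall c, c \notin B ->
  forall t, strand v c t = 0.
Proof.
exists [seq (m + a t)%MM | t <- enum T, m <- msupp (v t)] => c cB t.
apply/eqP; apply: contraNT cB => st; apply/allpairsPdep.
have atc := strand_neq0 st; exists t, (c - a t)%MM.
by move: st; rewrite mem_enum submK // /strand atc mcoeff_msupp.
Qed.

(** With [strand_inj], this lets preimages under multigraded maps be found one
    multidegree at a time. *)
Lemma strand_lift (y : mon -> T -> K) (B : seq mon) :
  (forall c t, y c t != 0 -> (a t <= c)%MM) ->
  (forall c, c \notin B -> forall t, y c t = 0) ->
  exists v, forall c t, strand v c t = y c t.
Proof.
move=> ya yB.
exists [ffun t => \sum_(c <- undup B) y c t *: 'X_[K, (c - a t)%MM]] => c t.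
rewrite /strand ffunE; case: ifP => atc; last first.
  by apply/esym/eqP; apply: contraFT atc; apply: ya.
rewrite raddf_sum /=.
have coef c' : (y c' t *: 'X_[K, (c' - a t)%MM])@_(c - a t) = (c' == c)%:R * y c t.
  rewrite mcoeffZ mcoeffX; have [-> | nc] := eqVneq c' c; first by rewrite eqxx mulr1 mul1r.
  have [yc|yc] := eqVneq (y c' t) 0; first by rewrite yc !mul0r.
  case: eqP => [E|_]; last by rewrite mulr0 mul0r.
  by case/eqP: nc; rewrite -(submK (ya _ _ yc)) E submK.
rewrite (eq_bigr _ (fun c' _ => coef c')) -mulr_suml.
have [cB|cB] := boolP (c \in B); last by rewrite yB // mulr0.
rewrite (bigD1_seq c) ?mem_undup ?undup_uniq //= eqxx big1 ?addr0 ?mul1r //.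
by move=> c' /negbTE ->.
Qed.

End Strands.

Section GMap.
Variables (T U : finType) (a : T -> mon) (b : U -> mon) (A : T -> U -> K).

Definition graded_mx : Prop := forall t u, A t u != 0 -> (b u <= a t)%MM.

(** The multigraded map with scalar matrix A; on each strand it acts as A. *)
Definition gmap_fun (v : {ffun T -> R^o}) : {ffun U -> R^o} :=
  [ffun u => \sum_t (v t : R) * (A t u *: 'X_[a t - b u])].

Fact gmap_fun_linear : linear gmap_fun.
Proof.
move=> c v w; apply/ffunP => u; rewrite !ffunE scaler_sumr -big_split /=.
by apply: eq_bigr => t _; rewrite !ffunE mulrDl scalerAl.
Qed.

Definition gmap : {linear {ffun T -> R^o} -> {ffun U -> R^o}} :=
  linear_of gmap_fun_linear.

Lemma strand_gmap v c u : graded_mx ->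
  strand b (gmap v) c u = act (strand a v c) A u.
Proof.
move=> gA; rewrite /strand /act /= ffunE; case: ifP => buc; last first.
  rewrite big1 // => t _; case: ifP => atc; last by rewrite mul0r.
  have [->|/gA but] := eqVneq (A t u) 0; first by rewrite mulr0.
  by rewrite (lepm_trans but atc) in buc.
rewrite raddf_sum; apply: eq_bigr => t _ /=.
have [->|/gA but] := eqVneq (A t u) 0; first by rewrite scale0r !mulr0 mcoeff0.
rewrite -scalerAr mcoeffZ mulrC; congr (_ * _).
case: ifP => atc.
  have -> : (c - b u = a t - b u + (c - a t))%MM.
    apply/mnmP => i; move/mnm_lepP/(_ i): buc; move/mnm_lepP/(_ i): atc.
    move/mnm_lepP/(_ i): but; rewrite !(mnmDE, mnmBE); lia.
  by rewrite mcoeffMX.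
apply: mcoeffMX_nle; apply: contraFN atc => /mnm_lepP le_ac.
apply/mnm_lepP => i; move/mnm_lepP/(_ i): buc; move: (le_ac i).
move/mnm_lepP/(_ i): but; rewrite !mnmBE; lia.
Qed.

End GMap.

Definition basis_vec (T : finType) (t : T) : {ffun T -> R^o} := [ffun t' => (t' == t)%:R].

Lemma strand_basis (T : finType) (a : T -> mon) t t' :
  strand a (basis_vec t) (a t) t' = (t' == t)%:R.
Proof.
rewrite /strand ffunE; have [->|_] := eqVneq t' t.
  rewrite lepm_refl mcoeff1 [_ == _](_ : _ = true) //.
  by apply/eqP/mnmP => i; rewrite mnmBE subnn mnm0E.
by case: ifP; rewrite ?mcoeff0.
Qed.

Lemma gmap_basis (T U : finType) (a : T -> mon) (b : U -> mon) A t :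
  gmap a b A (basis_vec t) = \sum_u (A t u *: 'X_[a t - b u] : R) *: basis_vec u.
Proof.
apply/ffunP => u; rewrite /= ffunE (bigD1 t) //= ffunE eqxx mul1r.
rewrite big1 ?addr0 => [|t' /negbTE nt]; last by rewrite ffunE nt mul0r.
rewrite sum_ffunE (bigD1 u) //= !ffunE eqxx big1 => [|u' nu].
  by rewrite addr0; apply/esym/mulr1.
by rewrite !ffunE eq_sym (negbTE nu); apply: mulr0.
Qed.

(** The scalar matrix of the multidegree-preserving part of an arbitrary linear
    map h. *)
Definition component (T U : finType) (a : T -> mon) (b : U -> mon)
    (h : {linear {ffun T -> R^o} -> {ffun U -> R^o}}) (t : T) : U -> K :=
  strand b (h (basis_vec t)) (a t).

(** This turns an equation d f = d h d between linear maps over R into an equation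
    between scalar matrices. *)
Lemma component_comp (S T U W : finType) (c : S -> mon) (a : T -> mon)
    (b : U -> mon) (d : W -> mon) A B
    (h : {linear {ffun T -> R^o} -> {ffun U -> R^o}}) s w :
  graded_mx c a A -> graded_mx b d B ->
  strand d (gmap b d B (h (gmap c a A (basis_vec s)))) (c s) w =
  act (act (A s) (component a b h)) B w.
Proof.
move=> gA gB; rewrite strand_gmap //; apply: eq_act => // u.
rewrite gmap_basis linear_sum strand_sum; apply: eq_bigr => t _.
rewrite linearZ /=; have [->|/gA le_t] := eqVneq (A s t) 0.
  rewrite mul0r scale0r scale0r /strand; case: ifP => // _.
  by rewrite ffunE mcoeff0.
rewrite strandX ?lem_subr //; congr (_ * strand _ _ _ _).
apply/mnmP => i; move/mnm_lepP/(_ i): le_t; rewrite !mnmBE; lia.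
Qed.

End GradedMaps.

(** * The bar complex of a family of monomials *)

Section BarComplex.
Variables (K : fieldType) (n : nat) (J : finType) (g : J -> 'X_{1..n}).
Local Notation R := {mpoly K[n]}.

(** The coefficient of u in the alternating sum of the faces of the tuple t, by
    recursion on the rule d(j :: t) = t - j :: d t. *)
Fixpoint face_coef (t u : seq J) : K :=
  if t is j :: t' then
    (t' == u)%:R - (if u is k :: u' then (j == k)%:R * face_coef t' u' else 0)
  else 0.

Definition seq_lcm (t : seq J) : 'X_{1..n} := \big[@mlcm n/0%MM]_(j <- t) g j.

Lemma seq_lcm_le t c : (seq_lcm t <= c)%MM = all (fun j => g j <= c)%MM t.
Proof.
rewrite /seq_lcm; elim: t => [|j t IH].
  by rewrite big_nil; apply/mnm_lepP => i; rewrite mnm0E.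
by rewrite big_cons lem_mlcm IH.
Qed.

Lemma face_coef_subset t u : face_coef t u != 0 -> {subset u <= t}.
Proof.
elim: t u => [|j t IH] [|k u] //=; first by rewrite eqxx.
have [<- _|_] := eqVneq t (k :: u).
  by move=> x xt; rewrite inE xt orbT.
rewrite sub0r oppr_eq0; have [-> |_] := eqVneq j k; last by rewrite mul0r eqxx.
rewrite mul1r => /IH ut x; rewrite !inE => /orP[-> //|/ut ->]; exact: orbT.
Qed.

Lemma face_coef_lcm t u : face_coef t u != 0 -> (seq_lcm u <= seq_lcm t)%MM.
Proof.
move=> /face_coef_subset ut; rewrite seq_lcm_le; apply/allP => j /ut.
by move: j; apply/allP; rewrite -seq_lcm_le lepm_refl.
Qed.

Lemma thead_cons i j (v : i.-tuple J) : thead (cons_tuple j v) = j.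
Proof. by rewrite /thead (tnth_nth j). Qed.

Lemma behead_cons i j (v : i.-tuple J) : behead_tuple (cons_tuple j v) = v.
Proof. exact: val_inj. Qed.

Lemma cons_thead_behead i (v : i.+1.-tuple J) :
  cons_tuple (thead v) (behead_tuple v) = v.
Proof. by apply: val_inj; case/tupleP: v => j v /=; rewrite theadE. Qed.

Lemma cons_tuple_bij i :
  {on predT, bijective (fun p : J * i.-tuple J => cons_tuple p.1 p.2)}.
Proof.
exists (fun v => (thead v, behead_tuple v)) => [[j v] _|v _].
  by rewrite /= thead_cons behead_cons.
exact: cons_thead_behead.
Qed.

Lemma big_tuple_cons i (F : seq J -> K) :
  \sum_(v : i.+1.-tuple J) F v = \sum_j \sum_(v : i.-tuple J) F (j :: v).
Proof.
rewrite pair_big /= (reindex (fun p : J * i.-tuple J => cons_tuple p.1 p.2)) //.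
exact: cons_tuple_bij.
Qed.

Lemma sum_delta_tuple i (F : seq J -> K) (t : i.-tuple J) :
  \sum_(v : i.-tuple J) (tval t == v)%:R * F v = F t.
Proof.
rewrite (bigD1 t) //= eqxx mul1r big1 ?addr0 // => v /negbTE vt.
by rewrite eq_sym val_eqE vt mul0r.
Qed.

Lemma sum_delta_head i j (F : seq J -> K) :
  \sum_k \sum_(v : i.-tuple J) (j == k)%:R * F (k :: v) = \sum_(v : i.-tuple J) F (j :: v).
Proof.
rewrite (bigD1 j) //= [X in _ + X]big1 ?addr0 => [|k /negbTE jk].
  by apply: eq_bigr => v _; rewrite eqxx mul1r.
by apply: big1 => v _; rewrite eq_sym jk mul0r.
Qed.

Lemma sum_face_cons i j (t : i.+1.-tuple J) (G : seq J -> K) :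
  \sum_(v : i.+1.-tuple J) face_coef (j :: t) v * G v =
  G t - \sum_(v : i.-tuple J) face_coef t v * G (j :: v).
Proof.
rewrite /=; under eq_bigr do rewrite mulrBl; rewrite sumrB sum_delta_tuple.
congr (_ - _).
rewrite (big_tuple_cons i (fun v =>
  (if v is k :: u then (j == k)%:R * face_coef t u else 0) * G v)).
rewrite -(sum_delta_head i j (fun v => (if v is k :: u then face_coef t u else 0) * G v)).
by apply: eq_bigr => k _; apply: eq_bigr => v _; rewrite mulrA.
Qed.

Lemma face_coef_sq i (t : i.+2.-tuple J) (w : i.-tuple J) :
  act (fun v : i.+1.-tuple J => face_coef t v) (fun v (w : i.-tuple J) => face_coef v w) w = 0.
Proof.
rewrite /act; elim: i t w => [|i IH] t w; case/tupleP: t => j t.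
  rewrite (sum_face_cons j t (fun v => face_coef v w)) tuple0 /=.
  apply/eqP; rewrite subr_eq0; apply/eqP.
  rewrite -[LHS](sum_delta_tuple (fun v => face_coef t v) [tuple]).
  by apply: eq_bigr => v _; rewrite subr0 mulrC [[::] == _]eq_sym.
rewrite (sum_face_cons j t (fun v => face_coef v w)) /=.
case/tupleP: w => k w; under eq_bigr do rewrite /= mulrBr.
rewrite sumrB opprB addrCA.
have -> : \sum_(v : i.+1.-tuple J) face_coef t v * (tval v == k :: w)%:R = face_coef t (k :: w).
  rewrite -[RHS](sum_delta_tuple (fun v => face_coef t v) (cons_tuple k w)).
  by apply: eq_bigr => v _; rewrite mulrC eq_sym.
rewrite subrr addr0; under eq_bigr do rewrite mulrCA.
by rewrite -mulr_sumr IH mulr0.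
Qed.

(** Putting j in front of every tuple is a contracting homotopy:
    d(j :: y) = y - j :: d y, and d y = 0. *)
Lemma face_coef_cone i j (y : i.+1.-tuple J -> K) :
  (forall u : i.-tuple J, act y (fun v (w : i.-tuple J) => face_coef v w) u = 0) ->
  forall t : i.+1.-tuple J,
  act (fun u : i.+2.-tuple J => (j == thead u)%:R * y (behead_tuple u))
    (fun v (w : i.+1.-tuple J) => face_coef v w) t = y t.
Proof.
move=> y0 t; rewrite /act.
rewrite (reindex (fun p : J * i.+1.-tuple J => cons_tuple p.1 p.2)) /=; last exact: cons_tuple_bij.
rewrite -(pair_big xpredT xpredT (fun k (v : i.+1.-tuple J) =>
  (j == thead (cons_tuple k v))%:R * y (behead_tuple (cons_tuple k v)) * face_coef (k :: v) t)) /=.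
rewrite (bigD1 j) //= [X in _ + X]big1 ?addr0 => [|k /negbTE jk]; last first.
  by apply: big1 => v _; rewrite thead_cons eq_sym jk !mul0r.
have -> : \sum_(v : i.+1.-tuple J) (j == thead (cons_tuple j v))%:R *
    y (behead_tuple (cons_tuple j v)) * face_coef (j :: v) t =
    \sum_(v : i.+1.-tuple J) y v * face_coef (j :: v) t.
  by apply: eq_bigr => v _; rewrite thead_cons behead_cons eqxx mul1r.
case/tupleP: t => k t; under eq_bigr do rewrite /= mulrBr; rewrite sumrB.
under [X in _ - X]eq_bigr do rewrite mulrCA.
rewrite -mulr_sumr [X in _ * X](y0 t) mulr0 subr0.
rewrite (bigD1 (cons_tuple k t)) //= eqxx mulr1 big1 ?addr0 => [|v nv].
  by congr (y _); apply: val_inj.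
by rewrite -[tval v == _]/(val v == val (cons_tuple k t)) val_eqE (negbTE nv) mulr0.
Qed.

(** The factor q rescales the grading: the differential for q is obtained from the
    one for 1 by substituting x_i^q for x_i. *)
Definition bar_deg q i (t : i.-tuple J) : 'X_{1..n} := (seq_lcm t *+ q)%MM.

Definition bar i : lmodType R := {ffun i.-tuple J -> R^o}.

Definition bar_mx i (t : i.+1.-tuple J) (u : i.-tuple J) : K := face_coef t u.

Definition bar_diff q i : {linear bar i.+1 -> bar i} :=
  gmap (@bar_deg q i.+1) (@bar_deg q i) (@bar_mx i).

Lemma bar_mx_graded q i : graded_mx (@bar_deg q i.+1) (@bar_deg q i) (@bar_mx i).
Proof.
move=> t u /face_coef_lcm /mnm_lepP le_ut; apply/mnm_lepP => k.
by rewrite !mulmnE leq_mul.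
Qed.

Lemma bar_diffK q i x : bar_diff q i (bar_diff q i.+1 x) = 0.
Proof.
apply: (strand_inj (a := @bar_deg q i)) => c u; rewrite !strand_gmap; try exact: bar_mx_graded.
rewrite (eq_act (y' := act (strand (@bar_deg q i.+2) x c) (@bar_mx i.+1))
  (A' := @bar_mx i)) //; last first.
  by move=> t; rewrite strand_gmap //; apply: bar_mx_graded.
rewrite actA /act big1 => [|t _]; last by rewrite [X in _ * X]face_coef_sq mulr0.
by rewrite /strand ffunE mcoeff0 if_same.
Qed.

(** In multidegree c the strand is the augmented complex of all tuples of generators
    dividing c.  If there is such a generator it serves as a cone point;
    otherwise the strand is zero in positive degrees. *)
Lemma bar_exact i x : bar_diff 1 i x = 0 -> exists y, bar_diff 1 i.+1 y = x.
Proof.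
move=> dx.
(* The cone point chosen in multidegree c is any generator dividing c. *)
pose y c (u : i.+2.-tuple J) : K := if [pick j | (g j <= c)%MM] is Some j then
  (j == thead u)%:R * strand (@bar_deg 1 i.+1) x c (behead_tuple u) else 0.
have [B xB] := strand_finite (@bar_deg 1 i.+1) x.
have [c u|c cB t|z zE] := @strand_lift _ _ _ (@bar_deg 1 i.+2) y B.
- rewrite /y; case: pickP => [j gj|]; last by rewrite eqxx.
  have [ju|] := eqVneq j (thead u); last by rewrite mul0r eqxx.
  rewrite mul1r => /strand_neq0; case/tupleP: u ju => k u.
  rewrite /bar_deg !mulm1n !seq_lcm_le /thead (tnth_nth k) /= => <- ->.
  by rewrite gj.
- by rewrite /y; case: pickP => // j _; rewrite xB // mulr0.
exists z; apply: (strand_inj (a := @bar_deg 1 i.+1)) => c t.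
rewrite strand_gmap; last exact: bar_mx_graded.
rewrite (eq_act (y' := y c) (A' := @bar_mx i.+1)) // /y.
case: pickP => [j gj|none].
  apply: face_coef_cone => u; have := strand_gmap x c u (@bar_mx_graded 1 i).
  by rewrite -/(bar_diff 1 i) dx => <-; rewrite /strand ffunE mcoeff0 if_same.
rewrite /act big1 => [|u _]; last by rewrite mul0r.
apply/esym/eqP; apply: contraT => /strand_neq0.
by rewrite /bar_deg mulm1n seq_lcm_le; case/tupleP: t => k t /=; rewrite none.
Qed.

Lemma bar_diff0 q x :
  (bar_diff q 0 x) [tuple] = \sum_j (x [tuple j] : R) * 'X_[K, (g j *+ q)%MM].
Proof.
rewrite /= ffunE.
rewrite (reindex (fun j => [tuple j])) /=; last first.
  exists (fun v => thead v) => [j _|v _] /=; first by rewrite /thead (tnth_nth j).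
  by apply: val_inj; case/tupleP: v => j v /=; rewrite tuple0 /thead (tnth_nth j).
apply: eq_bigr => j _; rewrite /bar_mx /= subr0 scale1r; congr (_ * 'X_[_]).
rewrite /bar_deg /seq_lcm /= big_cons !big_nil mlcm0.
by apply/mnmP => k; rewrite mnmBE !mulmnE mnm0E mul0n subn0.
Qed.

End BarComplex.

(** * Radicals of ideals *)

Section Radicals.
Variable R : comNzRingType.
Implicit Types (J : R -> Prop) (r : seq R).

Definition ideal_pred J : Prop := J 0 /\ forall a b p, J a -> J b -> J (a + p * b).

Lemma ideal_predM J p a : ideal_pred J -> J a -> J (p * a).
Proof. by move=> [J0 JD] Ja; rewrite -[p * a]add0r; apply: JD. Qed.

Lemma ideal_pred_sum J (I : Type) (s : seq I) (P : pred I) (F : I -> R) :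
  ideal_pred J -> (forall i, P i -> J (F i)) -> J (\sum_(i <- s | P i) F i).
Proof.
move=> [J0 JD] JF; elim/big_ind: _ => // x y Jx Jy.
by rewrite -[y]mul1r; apply: JD.
Qed.

Lemma ideal_pred_expW J p k l : ideal_pred J -> (k <= l)%N -> J (p ^+ k) -> J (p ^+ l).
Proof. by move=> Jid /subnK <-; rewrite exprD; apply: ideal_predM. Qed.

Lemma ideal_gen_ideal r : ideal_pred (ideal_gen r).
Proof.
split=> [|_ _ p [a ->] [b ->]].
  by exists (fun _ => 0); rewrite big1 // => i _; rewrite mul0r.
exists (fun i => a i + p * b i); rewrite mulr_sumr -big_split /=.
by apply: eq_bigr => i _; rewrite mulrDl mulrA.
Qed.

Lemma ideal_gen_mem r x : x \in r -> ideal_gen r x.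
Proof.
move=> xr; have ir : (index x r < size r)%N by rewrite index_mem.
exists (fun i => (i == Ordinal ir)%:R).
rewrite (bigD1 (Ordinal ir)) //= eqxx mul1r nth_index // big1 ?addr0 //.
by move=> i /negbTE ->; rewrite mul0r.
Qed.

Lemma ideal_gen_min J r p : ideal_pred J ->
  (forall x, x \in r -> J x) -> ideal_gen r p -> J p.
Proof.
move=> Jid Jr [a ->]; apply: ideal_pred_sum => // i _.
by apply: ideal_predM => //; apply/Jr/mem_nth.
Qed.

Lemma radical_sub J p : J p -> radical J p.
Proof. by exists 1%N; rewrite expr1. Qed.

Lemma radical_ideal J : ideal_pred J -> ideal_pred (radical J).
Proof.
move=> Jid; split=> [|a b p [k Ja] [l Jb]].
  by exists 1%N; rewrite expr1; case: Jid.
exists (k + l)%N; rewrite exprDn; apply: ideal_pred_sum => // i _.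
rewrite -mulr_natl; apply: ideal_predM => //.
case: (leqP l i) => li.
  apply: ideal_predM => //; rewrite exprMn; apply: ideal_predM => //.
  exact: ideal_pred_expW li Jb.
rewrite mulrC; apply: ideal_predM => //; apply: ideal_pred_expW Ja => //.
by rewrite leq_subRL; lia.
Qed.

Lemma radical_radical J p : radical (radical J) p -> radical J p.
Proof. by move=> [k [l Jp]]; exists (k * l)%N; rewrite exprM. Qed.

Lemma uniform_exponent J (r : seq R) : ideal_pred J ->
  (forall x, x \in r -> radical J x) ->
  exists N, forall M x, (N <= M)%N -> x \in r -> J (x ^+ M).
Proof.
move=> Jid; elim: r => [|y r IH] Jr; first by exists 0%N.
have [k Jy] := Jr y (mem_head _ _).
have [|N NP] := IH; first by move=> x xr; apply: Jr; rewrite inE xr orbT.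
exists (maxn k N) => M x; rewrite geq_max => /andP[kM NM].
rewrite inE => /orP[/eqP ->|]; last exact: NP.
exact: ideal_pred_expW Jy.
Qed.

End Radicals.

(** * Projective dimension is at most the arithmetical rank *)

Section ProjDim.
Variables (K : fieldType) (n : nat).
Local Notation R := {mpoly K[n]}.

Lemma mpoly_colon_stabilizes : colon_stabilizes R.
Proof.
move=> J J0 JB r.
have [|k|k a Ja|c cP] := @mpoly_acc K n (fun k a => J (r ^+ k * a)).
- by move=> k a b p Ja Jb; rewrite mulrBr mulrCA; apply: JB.
- by rewrite mulr0.
- by rewrite exprS -mulrA -[_ * _]opprK -mulNr -[- (_ * _)]add0r; apply: JB.
- by exists c => k b; apply: cP.
Qed.

Lemma regular_projective : projective_module (R^o : lmodType R).
Proof.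
have iP : linear (fun x : R^o => [ffun _ : unit => x]).
  by move=> a x y; apply/ffunP => t; rewrite !ffunE.
have pP : linear (fun v : {ffun unit -> R^o} => v tt).
  by move=> a x y; rewrite !ffunE.
apply: (@projective_retract _ _ _ (linear_of iP) (linear_of pP)) => [|x].
  exact: free_projective.
by rewrite /= ffunE.
Qed.

Lemma product_projective (P Q : lmodType R) :
  projective_module P -> projective_module Q -> projective_module (P * Q)%type.
Proof.
move=> projP projQ A B g f sg.
have lP : linear (fun x : P => (x, 0) : P * Q).
  by move=> a x y; congr (_, _); rewrite /= scaler0 addr0.
have rP : linear (fun y : Q => (0, y) : P * Q).
  by move=> a x y; congr (_, _); rewrite /= scaler0 addr0.
have [h1 h1P] := projP _ _ g (f \o linear_of lP) sg.
have [h2 h2P] := projQ _ _ g (f \o linear_of rP) sg.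
have hP : linear (fun z : P * Q => h1 z.1 + h2 z.2).
  by move=> a x y; rewrite /= !linearP scalerDr addrACA.
exists (linear_of hP) => -[x y]; rewrite /= linearD /= h1P h2P /= -linearD.
by congr (f _); congr (_, _); rewrite /= ?addr0 ?add0r.
Qed.

Lemma koszul_projective (rs : seq R) i : projective_module (koszul rs i).
Proof.
elim: rs i => [|r rs IH] [|i] /=; try exact: regular_projective.
  exact: free_projective.
by apply: product_projective; [apply: (IH i.+1) | apply: (IH i)].
Qed.

End ProjDim.

Section BarOfIdeal.
Variables (K : fieldType) (n : nat) (s : seq 'X_{1..n}).
Variable I : submodClosed {mpoly K[n]}^o.
Hypothesis genI : monomials_generate s I.
Local Notation R := {mpoly K[n]}.
Local Notation g := (tnth (in_tuple s)).

Lemma submod_ideal_pred : ideal_pred (fun p : R => p \in I).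
Proof.
split=> [|a b p Ia Ib]; first exact: rpred0.
by apply: (rpredD Ia); apply: (rpredZ p Ib).
Qed.

Lemma sum_gens_mem (x : 'I_(size s) -> R) : \sum_j x j * 'X_[K, g j] \in I.
Proof.
apply: (@ideal_pred_sum _ (fun p : R => p \in I)) => [|j _].
  exact: submod_ideal_pred.
apply: (@ideal_predM _ (fun p : R => p \in I)); first exact: submod_ideal_pred.
by apply/genI/ideal_gen_mem/map_f/mem_tnth.
Qed.

Lemma mem_sum_gens p : p \in I -> exists x : 'I_(size s) -> R, p = \sum_j x j * 'X_[K, g j].
Proof.
move=> /genI [a ->]; have sz : size s = size [seq 'X_[K, m] | m <- s] by rewrite size_map.
exists (fun j => a (cast_ord sz j)).
rewrite (reindex (cast_ord sz)) /=; last first.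
  by exists (cast_ord (esym sz)) => j _; rewrite ?cast_ordK ?cast_ordKV.
apply: eq_bigr => j _; congr (_ * _).
by rewrite (nth_map 0%MM) //= (tnth_nth 0%MM).
Qed.

Definition bar_aug_fun (v : bar K n 'I_(size s) 0) : quotmod I := quot_pi I (v [tuple]).

Fact bar_aug_linear : linear bar_aug_fun.
Proof. by move=> a v w; rewrite /bar_aug_fun !ffunE linearP. Qed.

Definition bar_aug : {linear bar K n 'I_(size s) 0 -> quotmod I} := linear_of bar_aug_linear.

Lemma bar_resolution : is_resolution (bar_diff K g 1) bar_aug.
Proof.
split=> [v|v|i v].
- exists [ffun _ => repr (v : Quotient.quot (zmod_of I))].
  by rewrite /= /bar_aug_fun ffunE quot_piK.
- have augE : bar_aug v = 0 <-> v [tuple] \in I.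
    rewrite /= /bar_aug_fun -(linear0 (quot_pi I)); split=> [/eqP|vI].
      by rewrite quot_pi_eq subr0.
    by apply/eqP; rewrite quot_pi_eq subr0.
  apply: (iff_trans augE); split=> [/mem_sum_gens [x vE]|[x <-]].
    exists [ffun t => x (thead t)]; apply/ffunP => t; rewrite tuple0 bar_diff0 vE.
    by apply: eq_bigr => j _; rewrite ffunE mulm1n /thead (tnth_nth j).
  rewrite bar_diff0; under eq_bigr do rewrite mulm1n.
  exact: (sum_gens_mem (fun j => x [tuple j])).
- split=> [/bar_exact|[x <-]] //; exact: bar_diffK.
Qed.

Hypothesis sqfree : all (@squarefree_monomial n) s.

Lemma seq_lcm_squarefree (t : seq 'I_(size s)) k : (seq_lcm g t k <= 1)%N.
Proof.
rewrite /seq_lcm; elim: t => [|j t IH]; first by rewrite big_nil mnm0E.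
rewrite big_cons mnmE geq_max IH andbT.
by have /allP/(_ _ (mem_tnth j (in_tuple s)))/forallP/(_ k) := sqfree.
Qed.

(** Here squarefreeness enters: an exponent 0 or 1 that is at most
    q times another exponent is at most that exponent. *)
Lemma seq_lcm_le_pow t u q : (seq_lcm g u <= seq_lcm g t *+ q)%MM ->
  (seq_lcm g u <= seq_lcm g t)%MM.
Proof.
move=> /mnm_lepP le_ut; apply/mnm_lepP => k; move: (le_ut k).
rewrite mulmnE; have := seq_lcm_squarefree u k.
by case: (seq_lcm g t k) => [|c]; lia.
Qed.

Local Notation B i := (bar K n 'I_(size s) i).

(** The comparison map from the rescaled complex; it multiplies the basis vector of
    t by the (q-1)-st power of its degree. *)
Definition bar_pow q i : {linear B i -> B i} :=
  gmap (@bar_deg n _ g q i) (@bar_deg n _ g 1 i) (fun t u => (t == u)%:R).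

Lemma bar_pow_graded q i : (0 < q)%N ->
  graded_mx (@bar_deg n _ g q i) (@bar_deg n _ g 1 i) (fun t u => (t == u)%:R : K).
Proof.
move=> q0 t u; have [<- _|] := eqVneq t u; last by rewrite eqxx.
by apply/mnm_lepP => k; rewrite !mulmnE leq_mul.
Qed.

Lemma strand_bar_pow q i (x : B i) c t : (0 < q)%N ->
  strand (@bar_deg n _ g 1 i) (bar_pow q i x) c t = strand (@bar_deg n _ g q i) x c t.
Proof.
move=> q0; rewrite strand_gmap; last exact: bar_pow_graded.
rewrite /act (bigD1 t) //= eqxx mulr1 big1 ?addr0 // => u /negbTE ->.
by rewrite mulr0.
Qed.

Lemma bar_pow_diff q i x : (0 < q)%N ->
  bar_diff K g 1 i (bar_pow q i.+1 x) = bar_pow q i (bar_diff K g q i x).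
Proof.
move=> q0; apply: (strand_inj (a := @bar_deg n _ g 1 i)) => c u.
rewrite strand_bar_pow // !strand_gmap; try exact: bar_mx_graded.
by apply: eq_act => // t; rewrite strand_bar_pow.
Qed.

Lemma bar_pow0 q (x : B 0) : bar_pow q 0 x [tuple] = x [tuple].
Proof.
move: [tuple] => t0; rewrite /= ffunE (bigD1 t0) //= eqxx big1 ?addr0; last first.
  by move=> t /eqP[]; apply: val_inj; rewrite (tuple0 t) (tuple0 t0).
rewrite (tuple0 t0) scale1r /bar_deg /seq_lcm /= big_nil.
rewrite (_ : (_ - _)%MM = 0%MM) ?mpolyX0 ?mulr1 //.
by apply/mnmP => k; rewrite mnmBE !mulmnE !mnm0E.
Qed.

(** The multidegree-preserving part H of h m, for the rescaled grading on the source,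
    satisfies E H E = E for the matrix E of the differential.  It also respects
    the original gradings, so it defines the splitting. *)
Lemma bar_splitting q m (h : forall i, {linear B i -> B i.+1}) : (0 < q)%N ->
  (forall x, bar_diff K g 1 m (bar_pow q m.+1 x) =
             bar_diff K g 1 m (h m (bar_diff K g q m x))) ->
  exists sigma : forall i, {linear B i -> B i.+1}, forall x,
    bar_diff K g 1 m (sigma m (bar_diff K g 1 m x)) = bar_diff K g 1 m x.
Proof.
move=> q0 hP.
pose Hi i := component (@bar_deg n _ g q i) (@bar_deg n _ g 1 i.+1) (h i).
pose H := Hi m.
pose E := @bar_mx K 'I_(size s) m.
have EHE t w : act (act (E t) H) E w = E t w.
  rewrite -(component_comp (h m) t w (@bar_mx_graded K _ _ g q m) (@bar_mx_graded K _ _ g 1 m)).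
  rewrite -/(bar_diff K g q m) -/(bar_diff K g 1 m) -hP strand_gmap; last exact: bar_mx_graded.
  rewrite -[RHS](act_delta E t w); apply: eq_act => // u.
  by rewrite strand_bar_pow // strand_basis.
have gradedH : graded_mx (@bar_deg n _ g 1 m) (@bar_deg n _ g 1 m.+1) H.
  move=> t u; rewrite /H /Hi /component => /strand_neq0.
  by rewrite /bar_deg !mulm1n; apply: seq_lcm_le_pow.
exists (fun i => gmap (@bar_deg n _ g 1 i) (@bar_deg n _ g 1 i.+1) (Hi i)) => x.
apply: (strand_inj (a := @bar_deg n _ g 1 m)) => c w.
have gE := @bar_mx_graded K _ _ g 1 m.
rewrite !strand_gmap //.
transitivity (act (act (act (strand (@bar_deg n _ g 1 m.+1) x c) E) H) E w).
  apply: eq_act => // u; rewrite strand_gmap //; apply: eq_act => // t.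
  by rewrite strand_gmap.
rewrite actA actA; apply: eq_act => // t; rewrite -[RHS]EHE.
by rewrite [RHS]actA.
Qed.

(** The comparison map [bar_pow] and the composite through the Koszul complex both
    lift the projection onto the quotient by I, and the composite vanishes above
    degree size rs. *)
Theorem projective_dimension_le_arithmetical_rank (rs : seq R) :
  (forall p : R, radical (fun q => q \in I) p <-> radical (ideal_gen rs) p) ->
  has_projective_resolution (quotmod I) (size rs).
Proof.
move=> radE.
have Iid := submod_ideal_pred.
have [|N NP] := uniform_exponent (r := rs) Iid.
  by move=> r rrs; apply/radE/radical_sub/ideal_gen_mem.
have [N' [_ lift]] := koszul_chain_map (@mpoly_colon_stabilizes K n) rs N.
pose J := ideal_gen [seq r ^+ N' | r <- rs].
have Jid : ideal_pred J by apply: ideal_gen_ideal.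
have rad_gen p : radical (ideal_gen rs) p -> radical J p.
  move=> [k pk]; apply: radical_radical; exists k.
  apply: ideal_gen_min pk => [|r rrs]; first exact: radical_ideal.
  by exists N'; apply/ideal_gen_mem/map_f.
have [|q' qP] := uniform_exponent (r := [seq 'X_[K, m] | m <- s]) Jid.
  by move=> x xs; apply/rad_gen/radE/radical_sub/genI/ideal_gen_mem.
pose q := q'.+1; have q0 : (0 < q)%N by [].
have projB i : projective_module (B i) by apply: free_projective.
have evP : linear (fun v : B 0 => v [tuple]) by move=> a v w; rewrite !ffunE.
have [||x|f [f0 fd]] := lift (fun i => B i) (bar_diff K g q) (linear_of evP).
- exact: projB.
- exact: bar_diffK.
- rewrite /= -/(bar_diff K g q 0 x) bar_diff0; apply: ideal_pred_sum => // j _.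
  apply: ideal_predM => //; rewrite -mpolyXn; apply: qP => //.
  exact/map_f/mem_tnth.
have piP : linear (fun p : koszul rs 0 => quot_pi I p) by move=> a x y; rewrite linearP.
have [||k [k0 kd]] := chain_map_exists (P := koszul rs)
    (dP := fun i => @koszul_fun _ N rs i) (@koszul_projective K n rs) _ bar_resolution
    (a := linear_of piP).
- exact: koszul_funK.
- move=> x; rewrite /= -(linear0 (quot_pi I)); apply/eqP; rewrite quot_pi_eq subr0.
  apply: (@ideal_gen_min _ (fun p => p \in I) [seq r ^+ N | r <- rs]) => //.
    by move=> _ /mapP[r rrs ->]; apply: NP.
  by apply/koszul_im0P; exists x.
have [x|i x|h [_ hS]] := null_homotopy (P := fun i => B i) (dP := bar_diff K g q)
    projB (@bar_diffK _ _ _ g q) bar_resolution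
    (f := fun i => bar_pow q i \- (k i \o f i)).
- rewrite [LHS](_ : _ = bar_aug (bar_pow q 0 x) - bar_aug (k 0%N (f 0%N x))); last first.
    exact: linearB.
  by rewrite k0 f0 [bar_aug _](_ : _ = quot_pi I (bar_pow q 0 x [tuple])) // bar_pow0 subrr.
- rewrite [LHS](_ : _ = bar_diff K g 1 i (bar_pow q i.+1 x) -
      bar_diff K g 1 i (k i.+1 (f i.+1 x))); last exact: linearB.
  rewrite kd bar_pow_diff //; congr (_ - k i _); exact: fd.
have [|sigma sigmaP] := bar_splitting (q := q) (m := size rs) (h := h) q0.
  move=> x; set m := size rs.
  have -> : bar_pow q m.+1 x = bar_diff K g 1 m.+1 (h m.+1 x) + h m (bar_diff K g q m x).
    rewrite -hS [RHS](_ : _ = bar_pow q m.+1 x - k m.+1 (f m.+1 x)) //.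
    by rewrite (koszul_eq0 (f m.+1 x)) // linear0 subr0.
  by rewrite linearD bar_diffK add0r.
exact: truncated_projective_resolution bar_resolution projB sigmaP.
Qed.

End BarOfIdeal.

(** * Arithmetical rank is at most the Lyubeznik length *)

Section LyubeznikComplex.
Variables (K : fieldType) (n : nat) (s : seq 'X_{1..n}).
Local Notation R := {mpoly K[n]}.
Local Notation mu := (size s).
Local Notation g := (tnth (in_tuple s)).
Implicit Types D : {set 'I_mu}.

Lemma lcm_gens_le D c : (lcm_gens D <= c)%MM = [forall i in D, (g i <= c)%MM].
Proof.
rewrite /lcm_gens; transitivity (all (fun i => (i \in D) ==> (g i <= c)%MM) (index_enum 'I_mu)).
  elim: (index_enum _) => [|i r IH].
    by rewrite big_nil; apply/mnm_lepP => k; rewrite mnm0E.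
  by rewrite big_cons /=; case: ifP => // _; rewrite lem_mlcm IH.
apply/allP/forall_inP => [le_c i iD|le_c i _]; last exact/implyP/le_c.
by have /implyP := le_c i (mem_index_enum i); apply.
Qed.

Lemma lcm_gensS D D' : D \subset D' -> (lcm_gens D <= lcm_gens D')%MM.
Proof.
move=> /subsetP DD'; rewrite lcm_gens_le; apply/forall_inP => i /DD' iD'.
by move: i iD'; apply/forall_inP; rewrite -lcm_gens_le lepm_refl.
Qed.

Lemma L_admissibleP D :
  reflect (forall i j q : 'I_mu, i \in D -> j \in D -> (i < j)%N -> (q < i)%N ->
             ~~ (g q <= lcm_gens [set j in D | (i <= j)%N])%MM)
          (L_admissible D).
Proof.
apply: (iffP forall_inP) => [adm i j q iD jD ij qi|adm i iD].
  have /implyP := adm i iD; have -> : [exists j in D, (i < j)%N].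
    by apply/exists_inP; exists j.
  by move=> /(_ isT)/forallP/(_ q)/implyP; apply.
apply/implyP => /exists_inP[j jD ij]; apply/forallP => q; apply/implyP.
exact: adm ij.
Qed.

Lemma L_admissible_sub D D' : D \subset D' -> L_admissible D' -> L_admissible D.
Proof.
move=> DD' /L_admissibleP adm; apply/L_admissibleP => i j q iD jD ij qi.
have := adm i j q (subsetP DD' i iD) (subsetP DD' j jD) ij qi.
apply: contra => le_q; apply: lepm_trans le_q _; apply: lcm_gensS.
by apply/subsetP => k; rewrite !inE => /andP[/(subsetP DD') -> ->].
Qed.

(** The first alternative, that D itself contains an earlier generator, is harmless in
    the application, where earlier generators already vanish. *)
Lemma not_L_admissible_add (j : 'I_mu) D : L_admissible D -> ~~ L_admissible (j |: D) ->
  exists2 q : 'I_mu, (q < j)%N & q \in D \/ (g q <= lcm_gens (j |: D))%MM.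
Proof.
move=> /L_admissibleP admD.
have [/exists_inP[q qD qj] _|] := boolP [exists q in D, (q < j)%N]; first by exists q; auto.
rewrite negb_exists_in => /forall_inP geD nadm.
suff /exists_inP[q qj le_q] : [exists (q : 'I_mu | (q < j)%N), (g q <= lcm_gens (j |: D))%MM].
  by exists q; auto.
apply: contraR nadm; rewrite negb_exists_in => /forall_inP ndiv.
apply/L_admissibleP => i k q; rewrite !inE => /predU1P[-> _ _ qj|iD kjD ik qi].
  apply: contra (ndiv q qj) => le_q; apply: lepm_trans le_q _.
  by apply/lcm_gensS/subsetP => x; rewrite inE => /andP[].
have ji : (j <= i)%N by rewrite leqNgt geD.
have kD : k \in D by case/predU1P: kjD ik => // ->; rewrite ltnNge ji.
have [ij|nij] := eqVneq i j.
  rewrite ij in qi *; apply: contra (ndiv q qi) => le_q; apply: lepm_trans le_q _.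
  by apply/lcm_gensS/subsetP => x; rewrite inE => /andP[].
apply: contra (admD i k q iD kD ik qi) => le_q; apply: lepm_trans le_q _.
apply/lcm_gensS/subsetP => x; rewrite !inE => /andP[/predU1P[->|-> ->]] //.
by move=> ij; case/eqP: nij; apply/val_inj/anti_leq; rewrite ij ji.
Qed.

Definition gens_prod D : R := \prod_(i in D) 'X_[K, g i].

Lemma gens_prod_dvd (q : 'I_mu) D : (g q <= lcm_gens D)%MM ->
  exists p, gens_prod D = p * 'X_[K, g q].
Proof.
move=> le_q; have le_sum : (g q <= \sum_(i in D) g i)%MM.
  apply: lepm_trans le_q _; rewrite lcm_gens_le; apply/forall_inP => i iD.
  by rewrite (bigD1 i) //=; apply: lem_addr.
exists 'X_[K, (\sum_(i in D) g i)%MM - g q].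
by rewrite -mpolyXD submK // /gens_prod mprodXE.
Qed.

Lemma gens_prod_setU1 (j : 'I_mu) D : j \notin D ->
  gens_prod (j |: D) = 'X_[K, g j] * gens_prod D.
Proof. by move=> jD; rewrite /gens_prod big_setU1. Qed.

Definition admissible_sum k : R :=
  \sum_(D : {set 'I_mu} | L_admissible D && (#|D| == k)) gens_prod D.

(** Induction on j, with earlier generators in J.  Write X for the j-th generator and
    e k for the part of the k-th admissible sum over sets without j.  If j can be
    added to D, the product over j |: D is X times the product over D; if not,
    that multiple lies in J.  So e (k+1) + X * e k is in J for k < l, whence
    e k = (- X)^k modulo J.  No admissible set has l+1 elements, so X * e l is
    in J as well, and X^(l+1) is in J. *)
Lemma admissible_sums_radical (J : R -> Prop) l : ideal_pred J ->
  (forall p, radical J p -> J p) ->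
  (forall D, L_admissible D -> (#|D| <= l)%N) ->
  (forall k, (k < l)%N -> J (admissible_sum k.+1)) ->
  forall j, J 'X_[K, g j].
Proof.
move=> Jid radJ le_l Jsum j; have [m] := ubnP (j : nat).
elim: m j => // m IHm j; rewrite ltnS => le_jm.
have Jlt (q : 'I_mu) : (q < j)%N -> J 'X_[K, g q].
  by move=> qj; apply/IHm/(leq_trans qj).
have JD p q : J p -> J q -> J (p + q).
  by move=> Jp Jq; rewrite -[q]mul1r; case: Jid => _; apply.
have JM p q : J q -> J (p * q) by apply: ideal_predM.
have JB p q : J p -> J q -> J (p - q).
  by move=> Jp Jq; rewrite -mulN1r; apply: (JD _ _ Jp); apply: JM.
pose X : R := 'X_[K, g j].
pose e k := \sum_(D : {set 'I_mu} | (L_admissible D && (#|D| == k)) && (j \notin D)) gens_prod D.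
have Jbad D : j \notin D -> L_admissible D -> ~~ L_admissible (j |: D) -> J (X * gens_prod D).
  move=> jD admD /(not_L_admissible_add admD) [q qj [qD|le_q]].
    by apply: (JM); rewrite /gens_prod (bigD1 q) //= mulrC; apply: (JM); apply: Jlt.
  rewrite -gens_prod_setU1 //; have [p ->] := gens_prod_dvd le_q.
  by apply: (JM); apply: Jlt.
have Jstep k : (k < l)%N -> J (e k.+1 + X * e k).
  move=> kl.
  (* The error term collects the sets to which j cannot be added. *)
  pose z := \sum_(D : {set 'I_mu} | ((L_admissible D && (#|D| == k)) && (j \notin D)) &&
    ~~ L_admissible (j |: D)) X * gens_prod D.
  suff -> : e k.+1 + X * e k = admissible_sum k.+1 + z.
    apply: JD; first exact: Jsum.
    by apply: ideal_pred_sum => // D /andP[/andP[/andP[admD _] jD] nadm]; apply: Jbad.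
  rewrite /admissible_sum (bigID (fun D => j \in D)) /= addrAC addrC; congr (_ + _).
  rewrite mulr_sumr (bigID (fun D => L_admissible (j |: D))) /=; congr (_ + _).
  rewrite [RHS](reindex_onto (fun D => j |: D) (fun D => D :\ j)) /=; last first.
    by move=> D /andP[_ jD]; rewrite setD1K.
  rewrite [LHS](eq_bigr (fun D => gens_prod (j |: D))); last first.
    by move=> D /andP[/andP[_ jD] _]; rewrite gens_prod_setU1.
  apply: eq_bigl => D; rewrite setU11 andbT.
  have [jD|jD] := boolP (j \in D).
    rewrite andbF; apply/esym/negbTE; rewrite negb_and; apply/orP; right.
    by apply: contraL jD => /eqP <-; rewrite !inE eqxx.
  rewrite setU1K // eqxx !andbT cardsU1 jD add1n eqSS.
  have [admjD|] := boolP (L_admissible (j |: D)); last by rewrite !andbF.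
  by rewrite (L_admissible_sub (subsetUr _ _) admjD) andbT.
have Jpow k : (k <= l)%N -> J (e k - (- X) ^+ k).
  elim: k => [_|k IHk kl].
    have adm0 : L_admissible (set0 : {set 'I_mu}).
      by apply/L_admissibleP => i k q; rewrite inE.
    rewrite /e (bigD1 set0) /=; last by rewrite adm0 cards0 eqxx inE.
    rewrite /gens_prod big_set0 big1 => [|D]; last first.
      by move=> /andP[/andP[/andP[_]]]; rewrite cards_eq0 => /eqP ->; rewrite eqxx.
    by rewrite addr0 expr0 subrr; case: Jid.
  have -> : e k.+1 - (- X) ^+ k.+1 = (e k.+1 + X * e k) - X * (e k - (- X) ^+ k).
    by rewrite exprS mulrBr mulNr; ring.
  by apply: JB; [apply: Jstep | apply: (JM); apply: IHk; apply: ltnW].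
(* Adding j to a set of size l would give an admissible set of size l + 1. *)
have Jtop : J (X * e l).
  rewrite mulr_sumr; apply: ideal_pred_sum => // D /andP[/andP[admD /eqP cD] jD].
  apply: Jbad => //; apply/negP => /le_l; rewrite cardsU1 jD cD add1n.
  by rewrite ltnn.
apply: radJ; exists l.+1.
have -> : X ^+ l.+1 = (-1) ^+ l * (X * e l - X * (e l - (- X) ^+ l)).
  have -> : X * e l - X * (e l - (- X) ^+ l) = X * (- X) ^+ l by ring.
  by rewrite (exprNn X) [X * _]mulrCA signrMK exprS.
by apply: (JM); apply: JB => //; apply: (JM); apply: Jpow.
Qed.

End LyubeznikComplex.

(** * Comparison of the four numbers *)

Section Comparison.
Variables (K : fieldType) (n : nat) (I : submodClosed {mpoly K[n]}^o).
Local Notation R := {mpoly K[n]}.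

Section Generators.
Variable s : seq 'X_{1..n}.
Local Notation mu := (size s).
Local Notation g := (tnth (in_tuple s)).
Implicit Types D : {set 'I_mu}.

Theorem arithmetical_rank_le_lyubeznik_length l : monomials_generate s I ->
  (forall D, L_admissible D -> (#|D| <= l)%N) ->
  exists r : l.-tuple R, forall p : R,
    radical (fun q => q \in I) p <-> radical (ideal_gen r) p.
Proof.
move=> genI le_l; pose r := [tuple admissible_sum K s (val i).+1 | i < l].
have Iid : ideal_pred (fun p : R => p \in I) := submod_ideal_pred I.
have rid : ideal_pred (radical (ideal_gen r)) by apply/radical_ideal/ideal_gen_ideal.
exists r => p; split=> [[k /(mem_sum_gens genI) [x pk]]|[k pk]].
  apply: radical_radical; exists k; rewrite pk.
  apply: ideal_pred_sum => // j _; apply: ideal_predM => //.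
  apply: (admissible_sums_radical rid _ le_l) => [q|i il]; first exact: radical_radical.
  apply/radical_sub/ideal_gen_mem; apply/mapP.
  by exists (Ordinal il); rewrite ?mem_enum.
exists k; apply: (ideal_gen_min (J := fun p : R => p \in I)) pk => // _ /mapP[i _ ->].
apply: (@ideal_pred_sum _ (fun p : R => p \in I)) => // D /andP[_ cD].
have [D0|[j jD]] := set_0Vmem D; first by move: cD; rewrite D0 cards0.
rewrite /gens_prod (bigD1 j) //= mulrC; apply: (@ideal_predM _ (fun p : R => p \in I)) => //.
by apply/genI/ideal_gen_mem/map_f/mem_tnth.
Qed.

(** A generator divisible by another one could be dropped. *)
Lemma ordered_min_gens_antichain : ordered_min_gens I s ->
  forall q i : 'I_mu, (g q <= g i)%MM -> q = i.
Proof.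
move=> [uniq_s genI min_s] q i le_qi; apply/eqP/negPn/negP => qi.
have g_inj : injective g.
  by move=> a b; rewrite !(tnth_nth 0%MM) => /eqP; rewrite nth_uniq // => /eqP/val_inj.
pose s' := [seq m <- s | m != g i].
have sub_s : {subset s' <= s} by move=> m; rewrite mem_filter => /andP[].
suff genI' : monomials_generate s' I.
  by have := min_s s' sub_s genI' (g i) (mem_tnth _ _); rewrite mem_filter eqxx.
move=> p; split=> [/genI|]; last first.
  move=> genp; apply/genI; apply: ideal_gen_min genp; first exact: ideal_gen_ideal.
  by move=> _ /mapP[m /sub_s ms ->]; apply/ideal_gen_mem/map_f.
apply: ideal_gen_min => [|_ /mapP[m ms ->]]; first exact: ideal_gen_ideal.
have [->|mi] := eqVneq m (g i); last first.
  by apply/ideal_gen_mem/map_f; rewrite mem_filter mi.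
rewrite -(submK le_qi) mpolyXD; apply: ideal_predM; first exact: ideal_gen_ideal.
apply/ideal_gen_mem/map_f; rewrite mem_filter mem_tnth andbT.
by rewrite (inj_eq g_inj).
Qed.

(** A broken subset of D with least element d enlarges to the final segment of D
    from d, still broken.  One-element segments, which admissibility does not test,
    are never broken because the generators form an antichain. *)
Lemma preserved_admissible : ordered_min_gens I s ->
  forall D, preserved D = L_admissible D.
Proof.
move=> /ordered_min_gens_antichain anti D; apply/forallP/L_admissibleP => [presD|admD E].
  move=> i j q iD jD ij qi; apply/negP => le_q.
  have /implyP := presD [set j in D | (i <= j)%N].
  have -> : [set j in D | (i <= j)%N] \subset D.
    by apply/subsetP => x; rewrite inE => /andP[].
  move=> /(_ isT)/negP; apply; apply/exists_inP; exists i; first by rewrite inE iD leqnn.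
  apply/andP; split; first by apply/forall_inP => x; rewrite inE => /andP[].
  by apply/existsP; exists q; rewrite qi le_q.
apply/implyP => /subsetP ED; apply/negP => /exists_inP[d dE /andP[/forall_inP minE]].
move=> /existsP[u /andP[ud le_u]].
have {}le_u : (g u <= lcm_gens [set j in D | (d <= j)%N])%MM.
  apply: lepm_trans le_u _; apply/lcm_gensS/subsetP => x xE.
  by rewrite inE ED // minE.
have [/exists_inP[j jD dj]|] := boolP [exists j in D, (d < j)%N].
  by have := admD d j u (ED d dE) jD dj ud; rewrite le_u.
rewrite negb_exists_in => /forall_inP maxd.
suff ud' : u = d by rewrite ud' ltnn in ud.
apply: anti; apply: lepm_trans le_u _; rewrite lcm_gens_le; apply/forall_inP => x.
rewrite inE => /andP[xD dx]; have := maxd x xD; rewrite -leqNgt => xd.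
by rewrite (_ : x = d) ?lepm_refl //; apply/val_inj/anti_leq; rewrite xd dx.
Qed.

Lemma lyub_lengthP l : is_lyub_length K s l <->
  (exists2 D : {set 'I_mu}, L_admissible D & #|D| = l) /\
  (forall D, L_admissible D -> (#|D| <= l)%N).
Proof.
have nonzero t : (exists v : lyub_module K s t, v <> 0) <->
    exists2 D : {set 'I_mu}, L_admissible D & #|D| = t.
  split=> [[v v0]|[D admD cD]].
    have [D _|none] := pickP (xpredT : pred (symbol s t)).
      by have /andP[admD /eqP cD] := valP D; exists (val D).
    by case: v0; apply/ffunP => D; have := none D.
  have DP : L_admissible D && (#|D| == t) by rewrite admD cD eqxx.
  exists [ffun _ => 1] => /ffunP/(_ (Sub D DP : symbol s t)); rewrite !ffunE.
  by apply/eqP/oner_neq0.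
split=> [[/nonzero ex_l max_l]|[ex_l max_l]]; split=> //.
- by move=> D admD; apply/max_l/nonzero; exists D.
- exact/nonzero.
- by move=> j /nonzero [D admD <-]; apply: max_l.
Qed.

Lemma ps_order_lyub_length l : ordered_min_gens I s ->
  is_lyub_length K s l <-> ps_order s = l.
Proof.
move=> mins; have presE := preserved_admissible mins.
have adm0 : preserved (set0 : {set 'I_mu}).
  by rewrite presE; apply/L_admissibleP => i j q; rewrite inE.
have le_ps D : L_admissible D -> (#|D| <= ps_order s)%N.
  rewrite -presE /ps_order => presD.
  exact: (@leq_bigmax_cond _ (@preserved n s) (fun A => #|A|)).
have [D presD psD] : {D : {set 'I_mu} | preserved D & ps_order s = #|D|}.
  by apply: eq_bigmax_cond; apply/card_gt0P; exists set0.
split=> [/lyub_lengthP [[E admE <-] max_l]|<-].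
  by apply/anti_leq; rewrite le_ps // psD max_l -?presE.
by apply/lyub_lengthP; split=> //; exists D; rewrite -?presE.
Qed.

Lemma lyub_module_free t : projective_module (lyub_module K s t).
Proof. exact: free_projective. Qed.

(** If the resolution could be shortened, every element of the last module would have
    coordinates in the ideal of the variables; a vector with coordinates 1 does
    not. *)
Lemma minimal_lyub_projdim l : is_lyub_length K s l ->
  lyub_is_minimal_free_resolution s I -> is_projdim (quotmod I) l.
Proof.
move=> [[v v0] max_l] [resL minL].
have zeroL t : (l < t)%N -> forall x : lyub_module K s t, x = 0.
  move=> lt x; apply: NNPP => x0.
  by have := max_l t (ex_intro _ x x0); rewrite leqNgt lt.
split.
  exists (lyub_module K s), (fun t => lyub_diff (K := K) (s := s) (t := t)), (lyub_aug (s := s) I).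
  by split=> // t; apply: lyub_module_free.
move=> j resj; rewrite leqNgt; apply/negP => jl.
have minL' i (w : lyub_module K s i.+1) : exists u : 'I_n -> lyub_module K s i,
    lyub_diff w = \sum_k ('X_k : R) *: u k by apply: minL.
have := minimal_resolution_length resL lyub_module_free (zeroL l.+1 (ltnSn l)) minL' resj jl.
have [D _|none] := pickP (xpredT : pred (symbol s l)); last first.
  by case: v0; apply/ffunP => D; have := none D.
move=> /(_ [ffun _ => 1]) [u /ffunP/(_ D)]; rewrite sum_ffunE ffunE => one.
have := congr1 (mcoeff 0%MM) one; rewrite mcoeff1 eqxx raddf_sum big1 => [|k _].
  by apply/eqP/oner_neq0.
rewrite ffunE /= [_ *: _](_ : _ = (u k D : R) * 'X_k); last exact: mulrC.
by rewrite mcoeffMX_nle // lep1mP mnm0E.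
Qed.

End Generators.

(** As pd(R/I) is a lower bound for both ara(I) and the length of any Lyubeznik
    resolution, it suffices that one order attains it. *)
Lemma all_ranks_equal k s : squarefree_monomial_ideal I ->
  ordered_min_gens I s -> is_lyub_length K s k -> is_projdim (quotmod I) k ->
  [/\ is_ara I k, is_projdim (quotmod I) k, is_L I k & is_ps I k].
Proof.
move=> [s0 [sqfree genI]] mins lens pdk.
have ara_of t l : ordered_min_gens I t -> is_lyub_length K t l ->
    exists r : l.-tuple R, forall p : R,
      radical (fun q => q \in I) p <-> radical (ideal_gen r) p.
  move=> [_ gent _] /lyub_lengthP[_ max_l].
  exact: arithmetical_rank_le_lyubeznik_length gent max_l.
have k_le_ara m (r : m.-tuple R) : (forall p : R,
    radical (fun q => q \in I) p <-> radical (ideal_gen r) p) -> (k <= m)%N.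
  move=> /(projective_dimension_le_arithmetical_rank genI sqfree).
  by rewrite size_tuple; apply: (proj2 pdk).
have k_le_L t l : ordered_min_gens I t -> is_lyub_length K t l -> (k <= l)%N.
  by move=> mint /(ara_of _ _ mint) [r /k_le_ara].
split=> //; split.
- exact: ara_of lens.
- by move=> m [r /k_le_ara].
- by exists s.
- by move=> l [t [mint lent]]; apply: k_le_L lent.
- by exists s; split=> //; apply/ps_order_lyub_length.
- move=> l [t [mint pst]]; apply: (k_le_L t) => //.
  exact/ps_order_lyub_length.
Qed.

End Comparison.

Theorem corollary5p10 (K : fieldType) (n : nat) (I : submodClosed {mpoly K[n]}^o)
    (hI : squarefree_monomial_ideal I)
    (hL : lyubeznik_ideal I \/ almost_lyubeznik_ideal I) :
  exists k : nat,
    [/\ is_ara I k, is_projdim (quotmod I) k, is_L I k & is_ps I k].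
Proof.
case: hL => [[s [mins res]]|[k [[[s [mins lens]] _] pdk]]]; last first.
  by exists k; apply: all_ranks_equal mins lens pdk.
have lens : is_lyub_length K s (ps_order s).
  exact/(ps_order_lyub_length (K := K) _ mins).
exists (ps_order s); exact: all_ranks_equal hI mins lens (minimal_lyub_projdim lens res).
Qed.
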